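(* Let $\mu>0$ and $2<p<6$, and let $\mathcal G$ be a connected metric graph. If $\mathcal G$ contains at least one half-line, then $$\inf_{u\in H^1_\mu(\mathcal G)} E(u,\mathcal G)\ \le\ \min_{\phi\in H^1_\mu(\mathbb R)} E(\phi,\mathbb R)=E(\phi_\mu,\mathbb R)$$ and, in the other direction, $$\inf_{u\in H^1_\mu(\mathcal G)} E(u,\mathcal G)\ \ge\ \min_{\phi\in H^1_\mu(\mathbb R^+)} E(\phi,\mathbb R^+)=\frac12 E(\phi_{2\mu},\mathbb R).$$
   Context: Metric graph: a connected multigraph $\mathcal G=(V,E)$ with $V$ and $E$ finite (multiple edges and self-loops allowed), where each edge $e\in E$ is associated with either a closed bounded interval $I_e=[0,\ell_e]$, $\ell_e>0$, or a closed half-line $I_e=[0,+\infty)$, with a coordinate $x_e$ along $I_e$ such that the ends of $I_e$ correspond to the two end vertices of $e$. If $I_e$ is a half-line, it is attached to the rest of the graph at $x_e=0$, and the vertex corresponding to $x_e=+\infty$ is called a vertex at infinity; $V_\infty\subseteq V$ is the set of vertices at infinity, and every vertex at infinity is assumed to have degree one. As a metric space, $\mathcal G$ is the disjoint union of the $I_e$ with endpoints glued at the vertices in $V\setminus V_\infty$ according to the graph, with the shortest-path distance (vertices at infinity are not points of this space). Functions: $u:\mathcal G\to\mathbb R$ is identified with the family $(u_e)_{e\in E}$ of its restrictions to the edges. $\|u\|_{L^r(\mathcal G)}^r=\sum_e\|u_e\|_{L^r(I_e)}^r$; $H^1(\mathcal G)$ is the set of $u$ continuous on $\mathcal G$ with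 $u_e\in H^1(I_e)$ for all $e$. For $\mu>0$, $H^1_\mu(\mathcal G)=\{u\in H^1(\mathcal G):\|u\|_{L^2(\mathcal G)}^2=\mu\}$. The NLS energy is $$E(u,\mathcal G)=\tfrac12\|u'\|_{L^2(\mathcal G)}^2-\tfrac1p\|u\|_{L^p(\mathcal G)}^p=\tfrac12\sum_e\int_{I_e}|u_e'|^2\,dx_e-\tfrac1p\sum_e\int_{I_e}|u_e|^p\,dx_e .$$ The same notation is used with $\mathcal G$ replaced by $\mathbb R$ or $\mathbb R^+=[0,+\infty)$. Soliton: $\phi_\mu$ denotes the unique positive and even minimizer of $E(\cdot,\mathbb R)$ over $H^1_\mu(\mathbb R)$ (the dependence on $p$ is understood). It is given by $\phi_\mu(x)=\mu^\alpha\phi_1(\mu^\beta x)$ with $\alpha=\frac{2}{6-p}$, $\beta=\frac{p-2}{6-p}$ and $\phi_1(x)=C_p\,\mathrm{sech}(c_p x)^{\alpha/\beta}$ for suitable constants $C_p,c_p>0$. *)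

(* Defs.v *)
From HB Require Import structures.
From mathcomp Require Import all_boot all_order all_algebra.
From mathcomp Require Import all_classical all_reals all_analysis.

Set Implicit Arguments.
Unset Strict Implicit.
Unset Printing Implicit Defensive.

Import Order.TTheory GRing.Theory Num.Theory.
Import numFieldNormedType.Exports.

Local Open Scope classical_set_scope.
Local Open Scope ring_scope.

Section SobolevInterval.
Context {R : realType}.
Implicit Types (I : set R) (u g phi : R -> R).

Local Notation leb := (@lebesgue_measure R).

Definition L2 I u : Prop :=
  measurable_fun I u /\ (\int[leb]_(x in I) ((u x) ^+ 2)%:E < +oo)%E.

(* C^1 functions with compact support in the interior of I *)
Definition test_function I phi : Prop :=
  [/\ forall x, derivable phi x 1, continuous (derive1 phi) &
      exists K : set R, [/\ compact K, K `<=` interior I &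
        forall x, ~ K x -> phi x = 0]].

Definition is_weak_derivative I u g : Prop :=
  forall phi, test_function I phi ->
    (\int[leb]_(x in I) (u x * derive1 phi x)%:E =
     - \int[leb]_(x in I) (g x * phi x)%:E)%E.

(* H^1(I) for an interval I; since I has dimension one, every class has a
   unique continuous representative, and that one is used throughout. *)
Definition H1 I u : Prop :=
  [/\ {within I, continuous u}, L2 I u &
      exists g, L2 I g /\ is_weak_derivative I u g].

(* The weak derivative of u on I in L^2(I); it is determined up to null sets
   when H1 I u holds, and unspecified otherwise. *)
Definition weak_derivative I u : R -> R :=
  get [set g | L2 I g /\ is_weak_derivative I u g].

Definition dirichlet I u : \bar R :=
  (\int[leb]_(x in I) ((weak_derivative I u x) ^+ 2)%:E)%E.

Definition mass I u : \bar R := (\int[leb]_(x in I) ((u x) ^+ 2)%:E)%E.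

Definition Lp_power (p : R) I u : \bar R :=
  (\int[leb]_(x in I) (`|u x| `^ p)%:E)%E.

Definition H1_mass I (mu : R) : set (R -> R) :=
  [set u | H1 I u /\ mass I u = mu%:E].

Definition energy (p : R) I u : \bar R :=
  ((2^-1)%:E * dirichlet I u - (p^-1)%:E * Lp_power p I u)%E.

End SobolevInterval.

(* m is the minimum of f over A, and it is attained *)
Definition is_minimum {R : realType} {T : Type} (f : T -> \bar R) (A : set T)
    (m : \bar R) : Prop :=
  (f @` A) m /\ lbound (f @` A) m.

Definition half_line {R : realType} : set R := `[0, +oo[.

Section Soliton.
Context {R : realType}.

Definition is_soliton (p mu : R) (phi : R -> R) : Prop :=
  [/\ forall x, 0 < phi x,
      forall x, phi (- x) = phi x,
      H1_mass [set: R] mu phi &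
      is_minimum (energy p [set: R]) (H1_mass [set: R] mu)
        (energy p [set: R] phi)].

Definition soliton (p mu : R) : R -> R := get [set phi | is_soliton p mu phi].

End Soliton.

(* The underlying finite multigraph of a metric graph, with its edge lengths.
   Edge e is parametrised from [source e] (coordinate 0) to [target e]; length
   +oo means that e is a half-line, whose vertex at infinity is [target e]. *)
Record pre_metric_graph (R : realType) := PreMetricGraph {
  vertex : finType;
  edge : finType;
  source : edge -> vertex;
  target : edge -> vertex;
  edge_length : edge -> \bar R
}.

Section GraphNotions.
Context {R : realType} (G : pre_metric_graph R).

Definition is_half_line (e : edge G) : bool := edge_length e == +oo%E.

Definition at_infinity (v : vertex G) : bool :=
  [exists e : edge G, is_half_line e && (target e == v)].

(* self-loops count twice *)
Definition degree (v : vertex G) : nat :=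
  (#|[pred e : edge G | source e == v]| +
   #|[pred e : edge G | target e == v]|)%N.

Definition graph_adj : rel (vertex G) := fun v w =>
  [exists e : edge G, ((source e == v) && (target e == w)) ||
                      ((source e == w) && (target e == v))].

Definition edge_interval (e : edge G) : set R :=
  match edge_length e with
  | EFin l => `[0, l]
  | _ => half_line
  end.

End GraphNotions.

Record metric_graph (R : realType) := MetricGraph {
  graph_of :> pre_metric_graph R;
  edge_length_gt0 : forall e : edge graph_of, (0 < edge_length e)%E;
  degree_at_infinity :
    forall v : vertex graph_of, at_infinity v -> degree v = 1%N;
  metric_graph_connected :
    forall v w : vertex graph_of, connect (@graph_adj R graph_of) v w
}.

Section FunctionsOnGraphs.
Context {R : realType} (G : metric_graph R).

(* A function on G is the family of its restrictions to the edges. *)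
Implicit Types (u : edge G -> R -> R).

(* The restrictions agree at the endpoints glued at a common vertex, w being
   the vertex values.  At a vertex at infinity, which is not a point of G, w is
   unconstrained. *)
Definition glued u : Prop :=
  exists w : vertex G -> R, forall e : edge G,
    u e 0 = w (source e) /\
    (forall l : R, edge_length e = l%:E -> u e l = w (target e)).

(* As G carries the quotient topology of the disjoint union of its edges,
   u is continuous on G iff it is glued and continuous on each edge; the latter
   is part of H1. *)
Definition graph_H1 u : Prop :=
  glued u /\ forall e, H1 (edge_interval e) (u e).

Definition graph_H1_mass (mu : R) : set (edge G -> R -> R) :=
  [set u | graph_H1 u /\ (\sum_e mass (edge_interval e) (u e) = mu%:E)%E].

Definition graph_energy (p : R) u : \bar R :=
  ((2^-1)%:E * (\sum_e dirichlet (edge_interval e) (u e)) -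
   (p^-1)%:E * (\sum_e Lp_power p (edge_interval e) (u e)))%E.

End FunctionsOnGraphs.

Arguments graph_H1_mass {R} G mu.

(* Main.v *)
(* Let [M] be the maximum of [|u|] and [W t = sqrt (2/p (t^2 - |t|^p))]. Young's
   inequality [u'^2/2 + (M^(p-2) u^2 - |u|^p)/p >= M^(p/2) W(u/M) |u'|] bounds
   [E(u) + M^(p-2) mu / p] from below by [M^(p/2+1)] times the total variation of
   [F(u/M)], where [F' = W] and [F 0 = 0]. As [u] is arbitrarily small somewhere
   on each half-line, connectedness makes this variation at least [F 1], and on
   the real line at least [2 F 1]. The resulting bound depends on [M] only.
   Since [p < 6] it is minimal at a single [M], and there it is attained by the
   explicit soliton, because that soliton satisfies [phi' = - M^(p/2) W(phi/M)]
   on [0, +oo[. So neither compactness nor rearrangements are needed.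
   For the upper bound, a soliton is moved far away along a half-line, its tail
   is spread over the rest of the graph, and the mass is renormalized. *)

Require Import Defs.
From mathcomp Require Import all_boot all_order all_algebra.
From mathcomp Require Import all_classical all_reals all_analysis.
From mathcomp Require Import measurable_realfun zify ring lra.

Set Implicit Arguments.
Unset Strict Implicit.
Unset Printing Implicit Defensive.

Import Order.TTheory GRing.Theory Num.Theory.
Import numFieldNormedType.Exports.

Local Open Scope classical_set_scope.
Local Open Scope ring_scope.

(** * Functions in H1 of an interval *)

Section Ramp.
Context {R : realType}.
Implicit Types (x y : R).

(** [H1] gives only a continuous [u] and a weak derivative tested against C^1 functions, so even the
    fundamental theorem of calculus for [u] has to be derived, by testing with smoothed indicators.
    [F(u)] is never shown to be weakly differentiable: the inequality
    [|F(u y) - F(u x)| <= int |f(u)| |u'|] is enough. Both [weak_derivative] and [soliton] are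
    chosen by [get]; hence the Dirichlet integral of an explicit function requires uniqueness almost
    everywhere, and the energy of the chosen soliton is found by comparing minimal values. The
    integrals of the explicit soliton are not evaluated in closed form. They are all expressed by
    [primitive p 1], the constant of the lower bound, so that the two sides match algebraically. The
    condition [p < 6] says that the exponent [1 + p / 2] of the variation term exceeds the exponent
    [p - 2] of the mass term. The multiplicity [n] of the variation is 1 on the graph and on the
    half-line, and 2 on the line. *)

Definition pos_part x : R := (x + `|x|) / 2.

Lemma pos_part_ge0 x : 0 <= x -> pos_part x = x.
Proof. by move=> x0; rewrite /pos_part ger0_norm//; field. Qed.

Lemma pos_part_le0 x : x <= 0 -> pos_part x = 0.
Proof. by move=> x0; rewrite /pos_part ler0_norm//; field. Qed.

Lemma continuous_pos_part : continuous pos_part.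
Proof.
move=> x; apply: cvgM; last exact: cvg_cst.
by apply: cvgD; [exact: cvg_id|exact: norm_continuous].
Qed.

(** Squaring removes the corner of the positive part at 0: the difference quotient there is [h] for
    [h >= 0] and 0 otherwise. This makes [ramp] C^1, as [test_function] requires. *)
Lemma is_derive_pos_part_sqr x : is_derive x 1 (fun y => pos_part y ^+ 2) (2 * pos_part x).
Proof.
have [x0|x0|->] := ltgtP x 0.
- rewrite pos_part_le0 ?ltW// mulr0.
  apply: (near_eq_is_derive (f := cst 0)).
  near=> y; rewrite pos_part_le0 ?expr0n// ltW//; near: y.
  exact: lt_nbhsl.
- rewrite pos_part_ge0 ?ltW//.
  apply: (near_eq_is_derive (f := fun y => y ^+ 2)).
    near=> y; rewrite pos_part_ge0// ltW//; near: y.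
    exact: lt_nbhsr.
  have := is_deriveX 2 (is_derive_id x (1:R)); rewrite /= expr1 => /is_derive_eq; apply.
  by rewrite /GRing.scale/= mulr1.
- rewrite pos_part_le0// mulr0.
  have h : (fun h : R => h^-1 *: ((((fun y => pos_part y ^+ 2) \o shift 0) h) - pos_part 0 ^+ 2)) @ 0^' --> (0:R).
    apply/cvgrPdist_le => /= e e0; near=> h.
    rewrite sub0r normrN addr0 (pos_part_le0 (lexx 0)) expr0n/= subr0 /GRing.scale/=.
    have [h0|h0] := leP 0 h.
      have [->|hn0] := eqVneq h 0; first by rewrite invr0 mul0r normr0 ltW.
      rewrite pos_part_ge0// expr2 mulKf//.
      near: h; exact: dnbhs0_le.
    rewrite pos_part_le0 ?expr0n/= ?mulr0 ?normr0 ?ltW//.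
  split.
    by apply/cvg_ex; exists 0; apply: cvg_trans h; apply: near_eq_cvg; near=> h; rewrite /= [h *: _]mulr1.
  by rewrite -derive1E; apply/cvg_lim.
Unshelve. all: by end_near. Qed.

(* A C^1 step from 0 on ]-oo, 0] to 1 on [1, +oo[. *)
Definition ramp x : R :=
  2 * pos_part x ^+ 2 - 4 * pos_part (x - 2^-1) ^+ 2 + 2 * pos_part (x - 1) ^+ 2.

(** A triangle of height 2 over [0, 1], zero elsewhere: a nonnegative kernel of integral 1, whose
    rescalings concentrate just to the right of a point. *)
Definition dramp x : R := 4 * pos_part x - 8 * pos_part (x - 2^-1) + 4 * pos_part (x - 1).

Lemma ramp_le0 x : x <= 0 -> ramp x = 0.
Proof. by move=> x0; rewrite /ramp !pos_part_le0; [field|lra|lra|lra]. Qed.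

Lemma ramp_ge1 x : 1 <= x -> ramp x = 1.
Proof. by move=> x0; rewrite /ramp !pos_part_ge0; [field|lra|lra|lra]. Qed.

Lemma dramp_le0 x : x <= 0 -> dramp x = 0.
Proof. by move=> x0; rewrite /dramp !pos_part_le0; [ring|lra|lra|lra]. Qed.

Lemma dramp_ge1 x : 1 <= x -> dramp x = 0.
Proof. by move=> x0; rewrite /dramp !pos_part_ge0; [field|lra|lra|lra]. Qed.

Lemma dramp_ge0 x : 0 <= dramp x.
Proof.
have [x0|x0] := leP x 0; first by rewrite dramp_le0.
have [x1|x1] := leP 1 x; first by rewrite dramp_ge1.
rewrite /dramp (pos_part_ge0 (ltW x0)) (@pos_part_le0 (x - 1)); last by lra.
have [h|h] := leP x 2^-1; first by rewrite pos_part_le0; lra.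
by rewrite pos_part_ge0; lra.
Qed.

Lemma continuous_dramp : continuous dramp.
Proof.
have h (a b : R) : continuous (fun x => a * pos_part (x - b)).
  move=> x; apply: cvgM; first exact: cvg_cst.
  apply: (@continuous_comp _ _ _ (fun x => x - b) pos_part); last exact: continuous_pos_part.
  by apply: cvgB; [exact: cvg_id|exact: cvg_cst].
move=> x; apply: cvgD; last exact: h.
apply: cvgB; last exact: h.
by apply: cvgM; [exact: cvg_cst|exact: continuous_pos_part].
Qed.

Lemma is_derive_affine (f : R -> R) (k c x d : R) :
  is_derive (k * (x - c)) 1 f d ->
  is_derive x 1 (fun y => f (k * (y - c))) (k * d).
Proof.
move=> fd; rewrite mulrC.
apply: (@is_derive1_comp _ f (fun y => k * (y - c))).
have -> : (fun y => k * (y - c)) = k \*: (id - cst c) :> (R -> R) by [].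
by apply: is_derive_eq; rewrite subr0 /GRing.scale/= mulr1.
Qed.

Lemma is_derive_ramp x : is_derive x 1 ramp (dramp x).
Proof.
have h (b : R) : is_derive x 1 (fun x => pos_part (x - b) ^+ 2) (2 * pos_part (x - b)).
  have := @is_derive_affine (fun y => pos_part y ^+ 2) 1 b x _ (is_derive_pos_part_sqr _).
  by rewrite !mul1r; under eq_fun do rewrite mul1r.
have -> : ramp = 2 \*: (fun x => pos_part x ^+ 2) - 4 \*: (fun x => pos_part (x - 2^-1) ^+ 2)
   + 2 \*: (fun x => pos_part (x - 1) ^+ 2) :> (R -> R) by [].
have h0 := is_derive_pos_part_sqr x.
by apply: is_derive_eq; rewrite /GRing.scale/= /dramp; ring.
Qed.

Lemma ramp_itv x : 0 <= ramp x <= 1.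
Proof.
have [x0|x0] := leP x 0; first by rewrite ramp_le0// lexx ler01.
have [x1|x1] := leP 1 x; first by rewrite ramp_ge1// lexx ler01.
rewrite /ramp (pos_part_ge0 (ltW x0)) (@pos_part_le0 (x - 1)); last by lra.
by have [h|h] := leP x 2^-1; [rewrite pos_part_le0; nra|rewrite pos_part_ge0; nra].
Qed.

End Ramp.

(** * Integrals over compact intervals *)

Section Integrals.
Context {R : realType}.
Local Notation leb := (@lebesgue_measure R).
Implicit Types (I D : set R) (a b c : R) (f g u : R -> R).

Lemma measurable_cc a b : measurable (`[a, b] : set (measurableTypeR R)).
Proof. exact: measurable_itv. Qed.

Lemma integral_support D I (h : R -> \bar R) : D `<=` I ->
  (forall x, I x -> ~ D x -> h x = 0%E) ->
  (\int[leb]_(x in I) h x = \int[leb]_(x in D) h x)%E.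
Proof.
move=> DI h0; rewrite integral_mkcond [RHS]integral_mkcond.
apply: eq_integral => x _; rewrite !patchE.
have [xD|xD] := boolP (x \in D).
  by rewrite mem_set//; apply: DI; exact: set_mem.
case: ifPn => // xI; apply: h0; first exact: set_mem.
by move=> /mem_set; exact/negP.
Qed.

Lemma sqr_integrable I g : L2 I g -> leb.-integrable I (fun x => ((g x) ^+ 2)%:E).
Proof.
move=> [mg g2]; apply/integrableP; split.
  by apply/measurable_EFinP; exact: measurable_funX.
apply: le_lt_trans g2; rewrite le_eqVlt; apply/orP; left; apply/eqP.
by apply: eq_integral => x _; rewrite abse_EFin ger0_norm// sqr_ge0.
Qed.

(** Stands in for the Cauchy-Schwarz inequality: it makes square-integrable functions integrable on
    bounded intervals, and later turns a bound on [u ^+ 2] into one on the modulus of [u]. *)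
Lemma norm_le_1D_sqr (x : R) : `|x| <= 1 + x ^+ 2.
Proof. rewrite -real_normK ?num_real//; have := normr_ge0 x; move: `|x| => y; nra. Qed.

Lemma L2_integrable_cc I g a b : measurable I -> L2 I g -> `[a, b] `<=` I ->
  leb.-integrable `[a, b] (EFin \o g).
Proof.
move=> mI gI abI; have [mg _] := gI.
have i1 : leb.-integrable `[a, b] (fun x => (1 + (g x) ^+ 2)%:E).
  have -> : (fun x => (1 + (g x) ^+ 2)%:E) = (EFin \o cst 1) \+ (fun x => ((g x) ^+ 2)%:E) by [].
  apply: integrableD; first exact: measurable_cc.
    apply: measurable_bounded_integrable => //.
    - by apply: compact_finite_measure; exact: segment_compact.
    - exact: bounded_cst.
  by apply: integrableS (sqr_integrable gI) => //; exact: measurable_cc.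
apply: le_integrable i1; first exact: measurable_cc.
  by apply/measurable_EFinP; exact: measurable_funS mg.
move=> x _; rewrite !abse_EFin lee_fin (le_trans (norm_le_1D_sqr _))//.
exact: ler_norm.
Qed.

Lemma continuous_integrable_cc f a b : {within `[a, b], continuous f} ->
  leb.-integrable `[a, b] (EFin \o f).
Proof. by move=> cf; apply: continuous_compact_integrable => //; exact: segment_compact. Qed.

Lemma integral_cc_deriv (f df : R -> R) a b : a <= b -> continuous df ->
  (forall x : R, is_derive x 1 f (df x)) ->
  \int[leb]_(x in `[a, b]) df x = f b - f a.
Proof.
move=> + cdf fdf; rewrite le_eqVlt => /predU1P[->|ab].
  by rewrite set_itv1 Rintegral_set1 subrr.
have cf (x : R) : {for x, continuous f}.
  by apply/differentiable_continuous/derivable1_diffP; case: (fdf x).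
rewrite /Rintegral (@continuous_FTC2 _ df f)//.
- exact: continuous_subspaceT.
- split=> [x _||]; first by case: (fdf x).
    exact/cvg_at_right_filter/cf.
  exact/cvg_at_left_filter/cf.
- by move=> x _; rewrite derive1E; apply: derive_val.
Qed.

End Integrals.

(** * The fundamental theorem of calculus for weak derivatives *)

Section WeakDerivative.
Context {R : realType}.
Local Notation leb := (@lebesgue_measure R).
Implicit Types (I D : set R) (a b c : R) (f g u : R -> R).

(** The kernel [k * dramp (k * (x - c))] has integral 1 and lives on [c, c + 1/k], so only values of
    [u] to the right of [c] matter. Hence [c = a] is allowed, while [c < b] is strict. *)
Lemma ramp_average u a b c : a <= c < b -> {within `[a, b], continuous u} ->
  (fun n : nat => \int[leb]_(x in `[a, b]) (u x * (n.+1%:R * dramp (n.+1%:R * (x - c)))))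
    @ \oo --> u c.
Proof.
move=> /andP[ac cb] cu.
have cab : c \in `[a, b]%classic by rewrite inE/= in_itv/= ac ltW.
have ab : a <= b by rewrite (le_trans ac)// ltW.
have cb0 : 0 < b - c by rewrite subr_gt0.
apply/cvgrPdist_le => e e0.
have /subspace_continuousP/(_ c) := cu; rewrite -inE => /(_ cab).
move=> /cvgrPdist_le/(_ _ e0); rewrite near_withinE => /nbhs_ballP[d /= d0 de].
near=> n.
have kd : n.+1%:R^-1 < d by near: n; exact: near_infty_natSinv_lt (PosNum d0).
have kb : n.+1%:R^-1 < b - c.
  by near: n; exact: near_infty_natSinv_lt (PosNum cb0).
set k : R := n.+1%:R; have k0 : 0 < k by rewrite /k.
rewrite -/k in kd kb.
pose w x : R := k * dramp (k * (x - c)).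
have cw : continuous w.
  move=> x; apply: cvgM; first exact: cvg_cst.
  apply: (@continuous_comp _ _ _ (fun x => k * (x - c)) dramp); last exact: continuous_dramp.
  apply: cvgM; first exact: cvg_cst.
  by apply: cvgB; [exact: cvg_id|exact: cvg_cst].
have w0 x : 0 <= w x by rewrite mulr_ge0 ?(ltW k0)// dramp_ge0.
have iw : \int[leb]_(x in `[a, b]) w x = 1.
  have dw (x : R) : is_derive x 1 (fun y => ramp (k * (y - c))) (w x).
    by apply: is_derive_affine; exact: is_derive_ramp.
  rewrite (integral_cc_deriv ab cw dw) ramp_ge1; last first.
    by rewrite mulrC -ler_pdivrMr// div1r ltW.
  by rewrite ramp_le0 ?subr0// pmulr_rle0// subr_le0.
have cuw : {within `[a, b], continuous (fun x => u x * w x)}.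
  by move=> x; apply: cvgM; [exact: cu|exact: (continuous_subspaceT cw)].
have iuw := continuous_integrable_cc cuw.
have iw1 := continuous_integrable_cc (continuous_subspaceT cw : {within `[a, b], continuous w}).
have m1 : measurable (`[a, b] : set (measurableTypeR R)) by [].
have -> : u c - \int[leb]_(x in `[a, b]) (u x * w x) =
    \int[leb]_(x in `[a, b]) ((u c - u x) * w x).
  under [RHS]eq_Rintegral do rewrite mulrBl.
  rewrite (RintegralB m1 (integrableZl m1 (u c) iw1) iuw).
  by rewrite (RintegralZl _ m1 iw1) iw mulr1.
have icuw : leb.-integrable `[a, b] (EFin \o (fun x => (u c - u x) * w x)).
  have -> : (fun x => (u c - u x) * w x) = (fun x => u c * w x - u x * w x).
    by apply/funext => x; rewrite mulrBl.
  exact: (integrableB m1 (integrableZl m1 (u c) iw1) iuw).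
apply: le_trans (le_normr_Rintegral _ icuw) _ => //.
rewrite -[leRHS]mulr1 -iw -RintegralZl//.
apply: le_Rintegral => //.
- exact: (integrable_norm icuw).
- exact: (integrableZl m1 e iw1).
move=> x; rewrite /= in_itv/= => /andP[ax xb].
rewrite normrM (ger0_norm (w0 x)).
have [xc|cx] := leP x c.
  by rewrite /w dramp_le0 ?mulr0// pmulr_rle0// subr_le0.
have [kx|kx] := leP k^-1 (x - c).
  rewrite /w dramp_ge1 ?mulr0//.
  by rewrite mulrC -ler_pdivrMr// div1r.
apply: ler_wpM2r => //; apply: de => /=; last by rewrite in_itv/= ax.
by rewrite /ball/= distrC gtr0_norm ?subr_gt0// (lt_trans kx).
Unshelve. all: by end_near. Qed.

(** The difference of two ramps is a C^1 version of the indicator of ]a, b]. It returns to 0 only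
    after [b], within the length [k^-1], and the margin up to [b'] leaves room for that inside the
    interior of [I]. *)
Lemma ramp_test I a b b' (k : R) : 0 < k -> k^-1 <= b' - b -> a <= b ->
  `[a, b'] `<=` interior I ->
  test_function I (fun x => ramp (k * (x - a)) - ramp (k * (x - b))) /\
  derive1 (fun x => ramp (k * (x - a)) - ramp (k * (x - b))) =
    (fun x => k * dramp (k * (x - a)) - k * dramp (k * (x - b))) /\
  (forall x, ~ `[a, b']%classic x -> ramp (k * (x - a)) - ramp (k * (x - b)) = 0).
Proof.
move=> k0 kb ab abI.
set f := fun x : R => _ - _; set df := fun x : R => k * _ - _.
have dr (c x : R) : is_derive x 1 (fun y => ramp (k * (y - c))) (k * dramp (k * (x - c))).
  by apply: is_derive_affine; exact: is_derive_ramp.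
have fd (x : R) : is_derive x 1 f (df x).
  exact: (is_deriveB (dr a x) (dr b x)).
have f1 : derive1 f = df.
  by apply/funext => x; rewrite derive1E; apply: derive_val.
have f0 x : ~ `[a, b']%classic x -> f x = 0.
  rewrite /= in_itv/= => /negP; rewrite negb_and -!ltNge => /orP[xa|bx].
    rewrite /f !ramp_le0 ?subrr// pmulr_rle0// subr_le0 ?ltW//.
    by rewrite (lt_le_trans xa).
  rewrite /f !ramp_ge1 ?subrr// mulrC -ler_pdivrMr// div1r; lra.
split=> //; split.
- by move=> x; case: (fd x).
- rewrite f1 => x.
  have cd c : {for x, continuous (fun x => k * dramp (k * (x - c)))}.
    apply: cvgM; first exact: cvg_cst.
    apply: (@continuous_comp _ _ _ (fun x => k * (x - c)) dramp); last exact: continuous_dramp.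
    apply: cvgM; first exact: cvg_cst.
    by apply: cvgB; [exact: cvg_id|exact: cvg_cst].
  by apply: cvgB; exact: cd.
- exists [set` `[a, b']]; split=> //; exact: segment_compact.
Qed.

Lemma ramp_limit (a x : R) :
  (fun n : nat => ramp (n.+1%:R * (x - a))) @ \oo --> ((a < x)%R%:R : R).
Proof.
have [ax|xa] := ltP a x; last first.
  rewrite (_ : (fun n => _) = cst (0 : R)); first exact: cvg_cst.
  by apply/funext => n /=; rewrite ramp_le0// pmulr_rle0// subr_le0.
have xa0 : 0 < x - a by rewrite subr_gt0.
apply: cvg_near_cst; near=> n.
rewrite ramp_ge1// mulrC -ler_pdivrMr// div1r ltW//.
by near: n; exact: near_infty_natSinv_lt (PosNum xa0).
Unshelve. all: by end_near. Qed.

(** The weak formulation is tested with a smoothed indicator of ]a, b]. Its derivative consists of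
    two averaging kernels, which yield [u a - u b] in the limit; on the other side dominated
    convergence, with the modulus of [g] as bound, yields the integral of [g]. *)
Lemma weak_derivative_FTC_interior I u g a b b' : measurable I ->
  {within I, continuous u} -> L2 I g -> is_weak_derivative I u g ->
  a <= b -> b < b' -> `[a, b'] `<=` interior I ->
  \int[leb]_(x in `[a, b]) g x = u b - u a.
Proof.
move=> mI cu gI ug ab bb' abI.
have abI' : `[a, b'] `<=` I by move=> x /abI; exact: interior_subset.
have ab' : a < b' by rewrite (le_lt_trans ab).
have cu' : {within `[a, b'], continuous u} by exact: continuous_subspaceW cu.
have ig := L2_integrable_cc mI gI abI'.
have m1 : measurable (`[a, b'] : set (measurableTypeR R)) by [].
have bb0 : 0 < b' - b by rewrite subr_gt0.
pose w c (n : nat) (x : R) : R := n.+1%:R * dramp (n.+1%:R * (x - c)).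
pose phi (n : nat) (x : R) : R := ramp (n.+1%:R * (x - a)) - ramp (n.+1%:R * (x - b)).
have cw c n : continuous (w c n).
  move=> x; apply: cvgM; first exact: cvg_cst.
  apply: (@continuous_comp _ _ _ (fun x => _ * (x - c)) dramp); last exact: continuous_dramp.
  apply: cvgM; first exact: cvg_cst.
  by apply: cvgB; [exact: cvg_id|exact: cvg_cst].
have cphi n : continuous (phi n).
  have cr c : continuous (fun x : R => ramp (n.+1%:R * (x - c))).
    move=> x; apply: (@continuous_comp _ _ _ (fun x => _ * (x - c)) (@ramp R)).
      apply: cvgM; first exact: cvg_cst.
      by apply: cvgB; [exact: cvg_id|exact: cvg_cst].
    by apply/differentiable_continuous/derivable1_diffP; case: (is_derive_ramp (n.+1%:R * (x - c))).
  by move=> x; apply: cvgB; exact: cr.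
have cuw c n : leb.-integrable `[a, b'] (EFin \o (fun x => u x * w c n x)).
  apply: continuous_integrable_cc => x.
  by apply: cvgM; [exact: cu'|exact: (continuous_subspaceT (cw c n))].
have phi_itv n x : `|phi n x| <= 1.
  have /andP[? ?] := ramp_itv (n.+1%:R * (x - a)).
  have /andP[? ?] := ramp_itv (n.+1%:R * (x - b)).
  by rewrite ler_norml /phi; apply/andP; split; lra.
have mphi n : measurable_fun (`[a, b'] : set (measurableTypeR R)) (phi n).
  by apply: measurable_funTS; exact: continuous_measurable_fun.
have igphi n : leb.-integrable `[a, b'] (EFin \o (fun x => g x * phi n x)).
  apply: (@integrableMl _ _ _ _ _ m1 _ (phi n) ig) => //.
  exists 1; split; first exact: num_real.
  by move=> y y1 x _ /=; exact: le_trans (phi_itv n x) (ltW y1).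
(* The identity holds only once [1 / (n + 1)] fits into the margin [b' - b]. *)
have key : \forall n \near \oo,
    \int[leb]_(x in `[a, b']) (u x * w a n x) - \int[leb]_(x in `[a, b']) (u x * w b n x) =
    - \int[leb]_(x in `[a, b']) (g x * phi n x).
  near=> n.
  have kb : n.+1%:R^-1 <= b' - b.
    by rewrite ltW//; near: n; exact: near_infty_natSinv_lt (PosNum bb0).
  have k0 : 0 < n.+1%:R :> R by [].
  have [tphi [dphi phi0]] := ramp_test k0 kb ab abI.
  have := ug _ tphi.
  rewrite dphi (@integral_support _ `[a, b'])//; last first.
    move=> x _; rewrite /= in_itv/= => /negP; rewrite negb_and -!ltNge => /orP[xa|bx].
      rewrite !dramp_le0 ?mulr0 ?subr0 ?mulr0// pmulr_rle0// subr_le0 ?ltW//.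
      by rewrite (lt_le_trans xa).
    have d0 c : c <= b -> dramp (n.+1%:R * (x - c)) = 0.
      move=> cb; rewrite dramp_ge1// mulrC -ler_pdivrMr// div1r (le_trans kb)//.
      by apply: lerB => //; exact: ltW.
    by rewrite !d0// ?mulr0 ?subr0 ?mulr0.
  rewrite (@integral_support _ `[a, b'] _ (fun x => (g x * _)%:E))//; last first.
    by move=> x _ xab; rewrite phi0// mulr0.
  move=> /(congr1 fine); rewrite fineN => <-.
  under eq_integral do rewrite mulrBr.
  by rewrite -(RintegralB m1 (cuw a n) (cuw b n)).
have L : (fun n => \int[leb]_(x in `[a, b']) (u x * w a n x) -
    \int[leb]_(x in `[a, b']) (u x * w b n x)) @ \oo --> u a - u b.
  by apply: cvgB; apply: ramp_average; rewrite ?lexx//= ab.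
have sab : `]a, b] `<=` `[a, b'].
  move=> x /=; rewrite !in_itv/= => /andP[ax xb].
  by rewrite (ltW ax) (le_trans xb)// ltW.
have iab : leb.-integrable `]a, b] (EFin \o g) by apply: integrableS ig => //.
have igab : leb.-integrable `[a, b'] (EFin \o (g \_ `]a, b])).
  rewrite -restrict_EFin; apply/integrable_restrict => //.
  by rewrite (setIidr sab).
have Rt : (fun n => - \int[leb]_(x in `[a, b']) (g x * phi n x)) @ \oo -->
    - \int[leb]_(x in `[a, b']) (g \_ `]a, b]) x.
  apply: cvgN; apply: fine_cvg; rewrite fineK; last first.
    exact: integrable_fin_num.
  apply: (@dominated_cvg _ _ _ leb _ m1 _ _ (fun x => `|g x|%:E)) => //.
  - by move=> n; have /integrableP[] := igphi n.
  - move=> x _; apply: cvg_EFin; first by near=> n.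
    have -> : (g \_ `]a, b]) x = g x * ((a < x)%R%:R - (b < x)%R%:R).
      rewrite patchE mem_setE in_itv/=.
      have [ax|xa] := ltP a x.
        by have [bx|xb] := ltP b x; rewrite ?subrr ?mulr0 ?subr0 ?mulr1.
      by have [bx|xb] := ltP b x; rewrite ?subrr ?mulr0//; lra.
    apply: cvgM; first exact: cvg_cst.
    by apply: cvgB; exact: ramp_limit.
  - exact: (integrable_norm ig).
  - move=> n x _; rewrite abse_EFin lee_fin normrM ler_piMr//.
have Rt' : (fun n => \int[leb]_(x in `[a, b']) (u x * w a n x) -
    \int[leb]_(x in `[a, b']) (u x * w b n x)) @ \oo -->
    - \int[leb]_(x in `[a, b']) (g \_ `]a, b]) x.
  by apply: cvg_trans Rt; apply: near_eq_cvg; apply: filterS key => n ->.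
have E : u a - u b = - \int[leb]_(x in `[a, b']) (g \_ `]a, b]) x.
  by apply: cvg_unique L Rt'.
move: E; rewrite -Rintegral_mkcondr (setIidr sab) Rintegral_itv_obnd_cbnd//.
by move/eqP; rewrite -eqr_oppLR opprB => /eqP.
Unshelve. all: by end_near. Qed.

(** Test functions vanish near the ends of [I], so [x] and [y] are reached by continuity: [u] minus
    the primitive [G] of [g] is constant on ]x, y[ and continuous on [x, y]. *)
Lemma weak_derivative_FTC I u g x y : is_interval I ->
  {within I, continuous u} -> L2 I g -> is_weak_derivative I u g ->
  I x -> I y -> x <= y ->
  \int[leb]_(t in `[x, y]) g t = u y - u x.
Proof.
move=> Iitv cu gI ug Ix Iy; rewrite le_eqVlt => /predU1P[->|xy].
  by rewrite set_itv1 Rintegral_set1 subrr.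
have mI : measurable I by exact: is_interval_measurable.
have xyI : `[x, y] `<=` I.
  by move=> t /=; rewrite in_itv/=; exact: Iitv.
have ig := L2_integrable_cc mI gI xyI.
have xyI' : `]x, y[ `<=` interior I.
  rewrite -open_subsetE; last exact: interval_open.
  by move=> t /=; rewrite in_itv/= => /andP[xt ty]; apply: xyI; rewrite /= in_itv/= !ltW.
pose G t := \int[leb]_(s in `[x, t]) g s.
have cG : {within `[x, y], continuous G}.
  by apply: parameterized_integral_continuous => //; exact: ltW.
have cuG : {within `[x, y], continuous (u - G)}.
  by move=> t; apply: cvgB; [exact: (continuous_subspaceW xyI cu)|exact: cG].
have GB a b : x <= a -> a <= b -> b <= y -> \int[leb]_(t in `[a, b]) g t = G b - G a.
  move=> xa ab b1.
  have ib : leb.-integrable `[x, b] (EFin \o g).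
    apply: integrableS ig => // t /=; rewrite !in_itv/= => /andP[-> tb].
    by rewrite (le_trans tb).
  rewrite /G Rintegral_itvB ?bnd_simp//.
  rewrite Rintegral_itv_obnd_cbnd//.
  apply: integrableS ib => // t /=; rewrite !in_itv/= => /andP[at' ->].
  by rewrite (le_trans xa)// ltW.
have uG a b : x < a -> a <= b -> b < y -> (u - G) a = (u - G) b.
  move=> xa ab b1.
  have E : \int[leb]_(t in `[a, b]) g t = u b - u a.
    apply: (@weak_derivative_FTC_interior I u g a b ((b + y) / 2)) => //.
      by lra.
    move=> t /=; rewrite in_itv/= => /andP[at' tb]; apply: xyI'.
    by rewrite /= in_itv/=; apply/andP; split; lra.
  move: E; rewrite (GB _ _ (ltW xa) ab (ltW b1)) => E.
  by rewrite /GRing.add/= /GRing.opp/=; lra.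
have [_ cx cy] := (continuous_within_itvP _ xy).1 cuG.
pose m := (x + y) / 2.
have xm : x < m by rewrite /m; lra.
have my : m < y by rewrite /m; lra.
have hx : (u - G) x = (u - G) m.
  suff cx' : (u - G) t @[t --> x^'+] --> (u - G) m by apply: cvg_unique cx cx'.
  apply: cvg_near_cst; near=> t; apply: uG => //.
  by near: t; exact: nbhs_right_le.
have hy : (u - G) y = (u - G) m.
  suff cy' : (u - G) t @[t --> y^'-] --> (u - G) m by apply: cvg_unique cy cy'.
  apply: cvg_near_cst; near=> t; apply/esym/uG => //.
  by near: t; exact: nbhs_left_ge.
rewrite (GB _ _ (lexx x) (ltW xy) (lexx y)).
have /= : u x - G x = u y - G y by apply: etrans hx (esym hy).
by lra.
Unshelve. all: by end_near. Qed.

End WeakDerivative.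

(** * The chain rule as an inequality *)

Section ChainRule.
Context {R : realType}.
Local Notation leb := (@lebesgue_measure R).
Implicit Types (I D : set R) (a b c x y : R) (f g u : R -> R).

(* Cousin's lemma, by a supremum argument. *)
Lemma additive_local_to_global (P : R -> R -> Prop) x y : x <= y ->
  (forall a b c, x <= a -> a <= b -> b <= c -> c <= y -> P a b -> P b c -> P a c) ->
  (forall r, x <= r <= y -> exists2 d, 0 < d & forall a b,
    x <= a -> a <= r -> r <= b -> b <= y -> r - d < a -> b < r + d -> P a b) ->
  P x y.
Proof.
move=> xy add loc.
pose A := [set t | x <= t <= y /\ P x t].
have Ax : A x.
  split; first by rewrite lexx.
  have [|d d0] := loc x; first by rewrite lexx.
  by apply; rewrite ?lexx//; lra.
have Ay : ubound A y by move=> t [/andP[]].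
have supA : has_sup A by split; [exists x|exists y].
pose S := sup A.
have xS : x <= S by apply: ub_le_sup => //; exists y.
have Sy : S <= y by apply: ge_sup => //; exists x.
have [|d d0 dP] := loc S; first by rewrite xS.
have [t [/andP[xt ty] Pt] St] := sup_adherent d0 supA.
have tS : t <= S by apply: ub_le_sup => //; [exists y|split=> //; rewrite xt].
have PS b : S <= b -> b <= y -> b < S + d -> P x b.
  move=> Sb b1 bd; apply: (add x t b) => //; first by rewrite (le_trans tS).
  exact: dP.
have [Sy'|] := ltP S y; last first.
  by move=> yS; apply: PS => //; have -> : y = S by [apply/le_anti; rewrite yS]; lra.
pose b := Num.min y (S + d / 2).
have Sb : S < b by rewrite /b lt_min Sy'/=; lra.
have b1 : b <= y by rewrite /b ge_min lexx.
have : b <= S.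
  apply: ub_le_sup; first by exists y.
  split; first by rewrite b1 andbT (le_trans xS)// ltW.
  apply: PS => //; first exact: ltW.
  by rewrite (@le_lt_trans _ _ (S + d / 2))//; [rewrite /b ge_min lexx orbT|lra].
by rewrite leNgt Sb.
Qed.

Lemma Rintegral_cc_add f x y z : x <= y -> y <= z ->
  leb.-integrable `[x, z] (EFin \o f) ->
  \int[leb]_(t in `[x, z]) f t =
  \int[leb]_(t in `[x, y]) f t + \int[leb]_(t in `[y, z]) f t.
Proof.
move=> xy yz ixz.
have := @Rintegral_itvB _ f (BLeft x) (BRight z) y ixz.
rewrite !bnd_simp => /(_ xy yz); rewrite Rintegral_itv_obnd_cbnd.
  by move=> <-; rewrite addrC subrK.
apply: integrableS ixz => // t /=; rewrite !in_itv/= => /andP[yt ->].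
by rewrite andbT (le_trans xy)// ltW.
Qed.

(** On a short interval the mean value theorem for [F] and the intermediate value theorem for [u]
    give [|F (u b) - F (u a)| = |f (u q)| |u b - u a|] with [q] in [a, b], and there [|f (u t)|]
    stays within [e] of [|f (u q)|]. [additive_local_to_global] adds up the local estimates. *)
Lemma chain_inequality I u g F f x y : is_interval I ->
  {within I, continuous u} -> L2 I g -> is_weak_derivative I u g ->
  (forall s : R, is_derive s 1 F (f s)) -> continuous f ->
  I x -> I y -> x <= y ->
  `|F (u y) - F (u x)| <= \int[leb]_(t in `[x, y]) (`|f (u t)| * `|g t|).
Proof.
move=> Iitv cu gI ug dF cf Ix Iy xy.
have mI : measurable I by exact: is_interval_measurable.
have xyI : `[x, y] `<=` I by move=> t /=; rewrite in_itv/=; exact: Iitv.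
have ig := L2_integrable_cc mI gI xyI.
have m1 : measurable (`[x, y] : set (measurableTypeR R)) by [].
have cu1 : {within `[x, y], continuous u} by exact: continuous_subspaceW cu.
have cfu : {within `[x, y], continuous (fun t => `|f (u t)|)}.
  move=> t; apply: continuous_comp; last exact: norm_continuous.
  by apply: continuous_comp; [exact: cu1|exact: cf].
have igf : leb.-integrable `[x, y] (EFin \o (fun t => `|f (u t)| * `|g t|)).
  have -> : EFin \o (fun t => `|f (u t)| * `|g t|) =
      ((fun t => (`|g t|%R)%:E) \* (EFin \o (fun t => `|f (u t)|%R)))%E.
    by apply/funext => t /=; rewrite mulrC.
  apply: integrableMl => //; first exact: (integrable_norm ig).
    by apply: subspace_continuous_measurable_fun.
  have /compact_bounded[M [_ mrt]] := continuous_compact cfu (@segment_compact _ x y).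
  exists M; split; first exact: num_real.
  by move=> z Mz t txy; apply: mrt => //; exists t.
have ign : leb.-integrable `[x, y] (EFin \o (fun t => `|g t|)) by exact: (integrable_norm ig).
have sub a b : x <= a -> b <= y -> `[a, b] `<=` `[x, y].
  move=> xa b1 t /=; rewrite !in_itv/= => /andP[at' tb].
  by rewrite (le_trans xa)//= (le_trans tb).
set J := \int[leb]_(t in _) _.
(* The slack is proportional to the integral of the modulus of [g]: being additive, it lets the
   local errors sum up to a small total. *)
suff main (e : R) : 0 < e -> `|F (u y) - F (u x)| <= J + e * \int[leb]_(t in `[x, y]) `|g t|.
  set K := \int[leb]_(t in `[x, y]) `|g t| in main.
  have K0 : 0 <= K by apply: Rintegral_ge0.
  apply/ler_addgt0Pr => e e0.
  have e1 : 0 < e / (K + 1) by rewrite divr_gt0// ltr_wpDl.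
  apply: le_trans (main _ e1) _; rewrite lerD2l.
  rewrite mulrAC ler_pdivrMr ?ltr_wpDl// ler_pM2l//; lra.
move=> e0.
have ige : leb.-integrable `[x, y] (EFin \o (fun t => `|f (u t)| * `|g t| + e * `|g t|)).
  exact: (integrableD m1 igf (integrableZl m1 e ign)).
rewrite /J -(RintegralZl e m1 ign) -(RintegralD m1 igf (integrableZl m1 e ign)).
have igS a b : x <= a -> b <= y -> leb.-integrable `[a, b]
    (EFin \o (fun t => `|f (u t)| * `|g t| + e * `|g t|)).
  by move=> xa b1; apply: integrableS ige => //; exact: sub.
pose P a b := `|F (u b) - F (u a)| <= \int[leb]_(t in `[a, b]) (`|f (u t)| * `|g t| + e * `|g t|).
apply: (@additive_local_to_global P) => //.
  move=> a b c xa ab bc cy Pab Pbc; rewrite /P (@Rintegral_cc_add _ a b c)//; last exact: igS.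
  apply: le_trans (lerD Pab Pbc).
  by rewrite -(subrKA (F (u b))) addrC ler_normD.
move=> r rxy.
have rin : `[x, y]%classic r by rewrite /= in_itv.
(* The values at [q] and at [t] are both compared with the value at [r], at a cost of [e / 2]
   each. *)
have e2 : 0 < e / 2 by rewrite divr_gt0.
have /subspace_continuousP/(_ _ rin)/cvgrPdist_le/(_ _ e2) := cfu.
rewrite near_withinE => /nbhs_ballP[d /= d0 dP].
exists d => // a b xa ar rb b1 rda brd.
have ab : a <= b by rewrite (le_trans ar).
have close t : t \in `[a, b] -> `| `|f (u r)| - `|f (u t)| | <= e / 2.
  rewrite in_itv/= => /andP[at' tb]; apply: dP.
    by rewrite /ball/= ltr_norml; apply/andP; split; lra.
  by rewrite in_itv/=; apply/andP; split; lra.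
have cuab : {within `[a, b], continuous u} by apply: continuous_subspaceW cu1; exact: sub.
have Ia : I a by apply: xyI; rewrite /= in_itv/=; apply/andP; split; lra.
have Ib : I b by apply: xyI; rewrite /= in_itv/=; apply/andP; split; lra.
have ugab := weak_derivative_FTC Iitv cu gI ug Ia Ib ab.
have igab : leb.-integrable `[a, b] (EFin \o g) by apply: integrableS ig => //; exact: sub.
have ignab : leb.-integrable `[a, b] (EFin \o (fun t => `|g t|)) by exact: (integrable_norm igab).
have m2 : measurable (`[a, b] : set (measurableTypeR R)) by [].
have cF s : {for s, continuous F}.
  by apply/differentiable_continuous/derivable1_diffP; case: (dF s).
have [q qab Fq] : exists2 q, q \in `[a, b] & `|F (u b) - F (u a)| = `|f (u q)| * `|u b - u a|.
  have mvt s t : s <= t -> exists2 z, s <= z <= t & F t - F s = f z * (t - s).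
    move=> st; have [|z] := @MVT_segment _ F f s t st (fun z _ => dF z).
      by apply: continuous_subspaceT => z; exact: cF.
    by rewrite in_itv/= => zst ->; exists z.
  have [uab|/ltW uba] := leP (u a) (u b).
    have [z zab E] := mvt _ _ uab.
    have [|q qab qz] := @IVT _ u a b z ab cuab; first by rewrite (min_idPl uab) (max_idPr uab).
    by exists q => //; rewrite qz -normrM E.
  have [z zab E] := mvt _ _ uba.
  have [|q qab qz] := @IVT _ u a b z ab cuab; first by rewrite (min_idPr uba) (max_idPl uba).
  by exists q => //; rewrite qz distrC E normrM (distrC (u a)).
rewrite /P Fq -ugab.
apply: (@le_trans _ _ (`|f (u q)| * \int[leb]_(t in `[a, b]) `|g t|)).
  by apply: ler_wpM2l => //; exact: le_normr_Rintegral.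
rewrite -(RintegralZl _ m2 ignab); apply: le_Rintegral => //.
- exact: (integrableZl m2 _ ignab).
- exact: igS.
move=> t tab; rewrite -mulrDl ler_wpM2r//.
have := close q qab; have := close t tab.
move: `|f (u t)| `|f (u q)| => A B.
by rewrite !ler_norml => /andP[? ?] /andP[? ?]; lra.
Qed.

End ChainRule.

(** * Uniqueness of the weak derivative, and C^1 functions *)

Section Uniqueness.
Context {R : realType}.
Local Notation leb := (@lebesgue_measure R).
Implicit Types (I D : set R) (a b c x y : R) (f g u : R -> R).

(** Lebesgue's differentiation theorem: almost everywhere [f] is the derivative of its primitive,
    which vanishes on [a, b]. Truncating [f] to [a, b] makes it integrable on the whole line. *)
Lemma zero_primitive_ae f a b : leb.-integrable `[a, b] (EFin \o f) ->
  (forall x, a <= x <= b -> \int[leb]_(t in `[a, x]) f t = 0) ->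
  {ae leb, forall x, a < x < b -> f x = 0}.
Proof.
move=> intf F0.
have m1 : measurable (`[a, b] : set (measurableTypeR R)) by [].
pose h := f \_ `[a, b].
have inth : leb.-integrable [set: R] (EFin \o h).
  by rewrite /h -restrict_EFin; apply/(integrable_restrict _ _ _ _).1; rewrite ?setTI.
have loch : locally_integrable [set: R] h by exact: integrable_locally_restrict.
have := @FTC1 R h (BLeft a) _ loch.
have ih y : leb.-integrable [set` Interval (BLeft a) (BRight y)] (EFin \o h).
  by apply: integrableS inth.
move=> /(_ ih); apply: filterS; first exact: (ae_filter_ringOfSetsType leb).
move=> x hx /andP[ax xb].
have [|_] := hx; first by rewrite lte_fin.
rewrite {2}/h patchE mem_set/= ?in_itv/= ?ltW// => <-.
rewrite derive1E; apply/esym.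
rewrite -(derive_cst (0 : R) x (1 : R)); apply: near_eq_derive.
near=> y.
have ay : a <= y by near: y; exact: lt_le_nbhsr.
have yb : y <= b by near: y; exact: lt_le_nbhsl.
rewrite /cst -(F0 y) ?ay//; apply: eq_Rintegral => t; rewrite inE/= in_itv/= => /andP[at' ty].
by rewrite /h patchE mem_set//= in_itv/= at'/= (le_trans ty).
Unshelve. all: by end_near. Qed.

(** On each segment [c n, d n] both candidates have the primitive [u - u (c n)], so their difference
    has primitive 0. Countably many segments cover [I], which keeps the exceptional set null. *)
Lemma weak_derivative_unique I u g1 g2 (c d : nat -> R) : is_interval I ->
  (forall n, I (c n) /\ I (d n)) -> (forall x, I x -> exists n, c n <= x <= d n) ->
  {within I, continuous u} ->
  L2 I g1 -> is_weak_derivative I u g1 -> L2 I g2 -> is_weak_derivative I u g2 ->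
  {ae leb, forall x, I x -> g1 x = g2 x}.
Proof.
move=> Iitv cdI cov cu g1I ug1 g2I ug2.
have mI : measurable I by exact: is_interval_measurable.
have ae1 n : {ae leb, forall x, c n < x < d n -> g1 x = g2 x}.
  have [Ic Id] := cdI n.
  have [cd|dc] := leP (c n) (d n); last first.
    by apply: aeW => x /andP[cx xd]; have := lt_trans cx (lt_trans xd dc); rewrite ltxx.
  have sub : `[c n, d n] `<=` I by move=> t /=; rewrite in_itv/=; exact: Iitv.
  have i1 := L2_integrable_cc mI g1I sub.
  have i2 := L2_integrable_cc mI g2I sub.
  have m1 : measurable (`[c n, d n] : set (measurableTypeR R)) by [].
  have /zero_primitive_ae : leb.-integrable `[c n, d n] (EFin \o (g1 \- g2)).
    exact: (integrableB m1 i1 i2).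
  have F0 x : c n <= x <= d n -> \int[leb]_(t in `[c n, x]) (g1 \- g2) t = 0.
    move=> /andP[cx xd].
    have subx : `[c n, x] `<=` `[c n, d n].
      by move=> t /=; rewrite !in_itv/= => /andP[-> tx]; rewrite (le_trans tx).
    have Ix : I x by apply: sub; rewrite /= in_itv/= cx.
    have j1 : leb.-integrable `[c n, x] (EFin \o g1) by apply: integrableS i1.
    have j2 : leb.-integrable `[c n, x] (EFin \o g2) by apply: integrableS i2.
    rewrite RintegralB// (weak_derivative_FTC Iitv cu g1I ug1 Ic Ix cx).
    by rewrite (weak_derivative_FTC Iitv cu g2I ug2 Ic Ix cx) subrr.
  move=> /(_ F0); apply: filterS; first exact: (ae_filter_ringOfSetsType leb).
  by move=> x /[apply] /eqP; rewrite subr_eq0 => /eqP.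
(* [ae1] covers only the open segments; their endpoints are countably many and form a null set. *)
have neq (p : R) : {ae leb, forall x, x <> p}.
  exists [set p]; split=> //; first exact: lebesgue_measure_set1.
  by move=> x /= /contrapT.
have aec : {ae leb, forall x n, x <> c n} by apply: ae_foralln => n; exact: neq.
have aed : {ae leb, forall x n, x <> d n} by apply: ae_foralln => n; exact: neq.
have ae2 : {ae leb, forall x n, c n < x < d n -> g1 x = g2 x} by exact: ae_foralln.
apply: filterS3 aec aed ae2; first exact: (ae_filter_ringOfSetsType leb).
move=> x xc xd h Ix; have [n /andP[cx xd']] := cov x Ix.
apply: (h n); rewrite !lt_neqAle cx xd' !andbT.
by apply/andP; split; apply/eqP => E; [exact: (xc n)|exact: (xd n)].
Qed.

(** [weak_derivative] is some element picked by [get]; by uniqueness almost everywhere, any weak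
    derivative at hand computes the Dirichlet integral. *)
Lemma dirichletE I u g (c d : nat -> R) : is_interval I ->
  (forall n, I (c n) /\ I (d n)) -> (forall x, I x -> exists n, c n <= x <= d n) ->
  {within I, continuous u} ->
  L2 I g -> is_weak_derivative I u g ->
  dirichlet I u = (\int[leb]_(x in I) (g x ^+ 2)%:E)%E.
Proof.
move=> Iitv cdI cov cu gI ug.
have mI : measurable (I : set (measurableTypeR R)) by exact: is_interval_measurable.
have [wI uw] : [set g | L2 I g /\ is_weak_derivative I u g] (weak_derivative I u).
  by apply: getPex; exists g.
rewrite /dirichlet; apply: ae_eq_integral => //.
- by have /integrableP[] := sqr_integrable wI.
- by have /integrableP[] := sqr_integrable gI.
have := weak_derivative_unique Iitv cdI cov cu wI uw gI ug.
apply: filterS; first exact: (ae_filter_ringOfSetsType leb).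
by move=> x h Ix; rewrite h.
Qed.

Lemma C1_weak_derivative I u du : (forall x : R, is_derive x 1 u (du x)) ->
  continuous du -> is_weak_derivative I u du.
Proof.
move=> dud cdu phi [dphi cphi [K [cK KI phi0]]].
have KI' : K `<=` I by move=> x /KI; exact: interior_subset.
have dphi0 x : ~ K x -> derive1 phi x = 0.
  move=> nKx; rewrite derive1E -(derive_cst (0 : R) x (1 : R)).
  have : \forall y \near x, ~ K y.
    by apply: open_nbhs_nbhs; split=> //; apply: closed_openC; exact: compact_closed cK.
  by move=> nK; apply: near_eq_derive; apply: filterS nK => y /phi0.
have [M [_ KM]] := compact_bounded cK.
(* [compact_bounded] says that every number above [M] bounds [K]. The margin 1 also places [- n] and
   [n] outside [K], so that the boundary terms of the integration by parts vanish. *)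
pose n : R := `|M| + 1.
have Kn : K `<=` `[- n, n].
  move=> x Kx; rewrite /= in_itv/= -ler_norml; apply: KM => //.
  by rewrite /n (le_lt_trans (ler_norm _))// ltrDl.
have nn : - n < n by have := normr_ge0 M; rewrite /n; lra.
have cu (x : R) : {for x, continuous u}.
  by apply/differentiable_continuous/derivable1_diffP; case: (dud x).
have cp (x : R) : {for x, continuous phi}.
  by apply/differentiable_continuous/derivable1_diffP; exact: dphi.
have Kpm (s : R) : n <= `|s| -> phi s = 0.
  move=> ns; apply: phi0 => Ks.
  have : `|s| <= `|M| + 2^-1.
    by apply: KM => //; rewrite (le_lt_trans (ler_norm _))// ltrDl.
  by move: ns; rewrite /n; lra.
(* [I] and [- n, n] may fail to be nested, so the integrals pass from one to the other through [K],
   which lies in both. *)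
rewrite !(@integral_support _ K I)//; first last.
- by move=> x _ nK; rewrite dphi0// mulr0.
- by move=> x _ nK; rewrite phi0// mulr0.
rewrite -!(@integral_support _ K `[- n, n])//; first last.
- by move=> x _ nK; rewrite dphi0// mulr0.
- by move=> x _ nK; rewrite phi0// mulr0.
have LR (f : R -> R) : (forall x, derivable f x 1) -> (forall x, {for x, continuous f}) ->
    derivable_oo_LRcontinuous f (- n) n.
  move=> df cf; split=> [x _||]; first exact: df.
    exact/cvg_at_right_filter/cf.
  exact/cvg_at_left_filter/cf.
have du' : forall x, derivable u x 1 by move=> x; case: (dud x).
have eu : {in `]- n, n[, derive1 u =1 du}.
  by move=> x _; rewrite derive1E; apply: derive_val.
have c1 : {within `[- n, n], continuous du} by exact: continuous_subspaceT.
have c2 : {within `[- n, n], continuous (derive1 phi)} by exact: continuous_subspaceT.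
rewrite (integration_by_parts nn c1 (LR u du' cu) eu c2 (LR phi dphi cp) (fun _ _ => erefl)).
by rewrite !Kpm ?mulr0 ?subrr ?sub0e// ?normrN ler_norm.
Qed.

Lemma C1_H1 I u du (c d : nat -> R) : is_interval I ->
  (forall n, I (c n) /\ I (d n)) -> (forall x, I x -> exists n, c n <= x <= d n) ->
  (forall x : R, is_derive x 1 u (du x)) -> continuous du ->
  (mass I u < +oo)%E -> (mass I du < +oo)%E ->
  H1 I u /\ dirichlet I u = mass I du.
Proof.
move=> Iitv cdI cov dud cdu uI duI.
have cu : continuous u.
  by move=> x; apply/differentiable_continuous/derivable1_diffP; case: (dud x).
have m f : continuous f -> measurable_fun I f.
  by move=> cf; apply: measurable_funTS; exact: continuous_measurable_fun.
have uL2 : L2 I u by split=> //; exact: m.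
have duL2 : L2 I du by split=> //; exact: m.
have wd := @C1_weak_derivative I u du dud cdu.
have cuI : {within I, continuous u} by exact: continuous_subspaceT.
by split; [split=> //; exists du|exact: (dirichletE Iitv cdI cov cuI duL2 wd)].
Qed.

End Uniqueness.

(** * The soliton *)

Section Potential.
Context {R : realType}.
Variables (p : R) (p_gt2 : 2 < p).
Local Notation leb := (@lebesgue_measure R).

Let p_gt0 : 0 < p. Proof. by rewrite (lt_trans _ p_gt2). Qed.

Lemma continuous_norm_powR : continuous (fun t : R => `|t| `^ p).
Proof.
move=> t; have [->|t0] := eqVneq t 0.
  have n0 (d : R) : 0 < d -> \forall s \near (0 : R), `|s| <= d.
    by move=> d0; apply/nbhs_ballP; exists d => //= y; rewrite /ball/= sub0r normrN => /ltW.
  apply/cvgrPdist_le => /= e e0; near=> s.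
  rewrite normr0 powR0 ?gt_eqF// sub0r normrN ger0_norm ?powR_ge0//.
  have [->|s0] := eqVneq s 0; first by rewrite normr0 powR0 ?gt_eqF// ltW.
  have s1 : `|s| <= 1 by near: s; exact: n0.
  apply: (@le_trans _ _ `|s|); last by near: s; exact: n0.
  rewrite -[leRHS]powRr1//; apply: ger_powR; last by rewrite (le_trans _ (ltW p_gt2))// ler1n.
  by rewrite normr_gt0 s0.
apply: (@continuous_comp _ _ _ (fun t : R => `|t|) (fun s => s `^ p)).
  exact: norm_continuous.
apply/differentiable_continuous/derivable1_diffP/derivable_powR.
by rewrite in_itv/= andbT normr_gt0.
Unshelve. all: by end_near. Qed.

(* On [0, 1], [v' = - potential v] is the equation of the decreasing half of a
   soliton of height 1; the potential vanishes outside [-1, 1], where the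
   radicand is negative. *)
Definition potential (t : R) : R := Num.sqrt (2 / p * (t ^+ 2 - `|t| `^ p)).

Lemma continuous_potential : continuous potential.
Proof.
have -> : potential = Num.sqrt \o (fun t => 2 / p * (t ^+ 2 - `|t| `^ p)) by [].
move=> t; apply: continuous_comp; last exact: sqrt_continuous.
apply: cvgM; first exact: cvg_cst.
by apply: cvgB; [exact: exprn_continuous|exact: continuous_norm_powR].
Qed.

Lemma potential_ge0 t : 0 <= potential t.
Proof. exact: sqrtr_ge0. Qed.

Lemma potentialN t : potential (- t) = potential t.
Proof. by rewrite /potential normrN sqrrN. Qed.

Lemma potential_sqr t : `|t| <= 1 ->
  potential t ^+ 2 = 2 / p * (t ^+ 2 - `|t| `^ p).
Proof.
move=> t1; rewrite sqr_sqrtr// mulr_ge0//; first by rewrite divr_ge0 ?ltW.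
rewrite subr_ge0 -real_normK ?num_real//.
have [->|t0] := eqVneq t 0; first by rewrite normr0 powR0 ?gt_eqF// expr0n.
rewrite -powR_mulrn//; apply: ger_powR; last exact: ltW.
by rewrite normr_gt0 t0.
Qed.

Lemma potential_gt0 t : 0 < t < 1 -> 0 < potential t.
Proof.
move=> /andP[t0 t1]; rewrite sqrtr_gt0 mulr_gt0//; first by rewrite divr_gt0.
rewrite subr_gt0 (gtr0_norm t0) -powR_mulrn ?ltW//.
rewrite /powR gt_eqF// ltr_expR ltr_nM2r//.
by rewrite ln_lt0// t0.
Qed.

Lemma potential_out t : 1 <= `|t| -> potential t = 0.
Proof.
move=> t1; apply/eqP; rewrite sqrtr_eq0 pmulr_rle0 ?divr_gt0//.
rewrite subr_le0 -real_normK ?num_real// -powR_mulrn//.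
exact: ler_powR (ltW p_gt2).
Qed.

Lemma integrable_potential : leb.-integrable setT (EFin \o potential).
Proof.
have -> : potential = potential \_ `[-1, 1].
  apply/funext => t; rewrite patchE; case: ifPn => //.
  rewrite notin_setE/= in_itv/= -ler_norml => /negP; rewrite -ltNge => t1.
  by rewrite potential_out// ltW.
rewrite -restrict_EFin; apply/(integrable_restrict _ _ _ _).1 => //.
rewrite setTI; apply: continuous_integrable_cc; apply: continuous_subspaceT.
exact: continuous_potential.
Qed.

(** Integrating from -oo gives one formula that is differentiable at every real point; the integral
    converges because [potential] vanishes outside [-1, 1]. *)
Definition half_primitive (s : R) : R := \int[leb]_(t in `]-oo, s]) potential t.

Lemma is_derive_half_primitive (s : R) :
  is_derive s 1 half_primitive (potential s).
Proof.
have [||||d1 d2] := @continuous_FTC1 R potential -oo%O s (s + 1).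
- by rewrite ltrDl.
- by apply: integrableS integrable_potential.
- by rewrite ltNyr.
- exact: continuous_potential.
by rewrite derive1E in d2; exact: DeriveDef d1 d2.
Qed.

(** As [potential] is even, the odd part of [half_primitive] is again a primitive of it: the one
    that vanishes at 0 and whose modulus depends on the modulus of [s] only. So the sign of [u]
    never matters. *)
Definition primitive (s : R) : R := (half_primitive s - half_primitive (- s)) / 2.

Lemma is_derive_primitive (s : R) : is_derive s 1 primitive (potential s).
Proof.
have h1 := is_derive_half_primitive s.
have h2 := is_derive1_comp (is_derive_half_primitive (- s)) (is_deriveNid s (1 : R)).
have -> : primitive = 2^-1 \*: (half_primitive - (half_primitive \o -%R)).
  by apply/funext => t; rewrite /primitive /GRing.scale/= mulrC.
by apply: is_derive_eq; rewrite potentialN /GRing.scale/=; field.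
Qed.

Lemma primitiveN s : primitive (- s) = - primitive s.
Proof. by rewrite /primitive opprK -mulNr opprB. Qed.

Lemma primitive0 : primitive 0 = 0.
Proof. by rewrite /primitive oppr0 subrr mul0r. Qed.

Lemma continuous_primitive : continuous primitive.
Proof.
move=> s; apply/differentiable_continuous/derivable1_diffP.
by case: (is_derive_primitive s).
Qed.

Lemma norm_primitive s : `|primitive s| = `|primitive `|s| |.
Proof.
have [s0|s0] := leP 0 s; first by rewrite (ger0_norm s0).
by rewrite (ltr0_norm s0) primitiveN normrN.
Qed.

Lemma primitive1_gt0 : 0 < primitive 1.
Proof.
have [|c c01] := @MVT _ primitive potential 0 1 ltr01 (fun s _ => is_derive_primitive s).
  by apply: continuous_subspaceT; exact: continuous_primitive.
rewrite primitive0 !subr0 mulr1 => ->; apply: potential_gt0.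
by move: c01; rewrite in_itv.
Qed.

End Potential.

(** * Hyperbolic functions and powers of sech *)

Section Hyperbolic.
Context {R : realType}.
Implicit Types x : R.

Definition cosh x : R := (expR x + expR (- x)) / 2.
Definition sinh x : R := (expR x - expR (- x)) / 2.
Definition tanh x : R := sinh x / cosh x.

Lemma cosh_ge1 x : 1 <= cosh x.
Proof.
rewrite /cosh expRN; have := expR_gt0 x; move: (expR x) => y y0.
rewrite ler_pdivlMr// mul1r -subr_ge0.
have -> : y + y^-1 - 2 = (y - 1) ^+ 2 / y by field; rewrite gt_eqF.
by rewrite divr_ge0 ?sqr_ge0// ltW.
Qed.

Lemma cosh_gt0 x : 0 < cosh x.
Proof. by rewrite (lt_le_trans _ (cosh_ge1 x)). Qed.

Lemma coshN x : cosh (- x) = cosh x.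
Proof. by rewrite /cosh opprK addrC. Qed.

Lemma cosh0 : cosh 0 = 1.
Proof. by rewrite /cosh oppr0 expR0; field. Qed.

Lemma sinh0 : sinh 0 = 0.
Proof. by rewrite /sinh oppr0 expR0 subrr mul0r. Qed.

Lemma sinh_ge0 x : 0 <= x -> 0 <= sinh x.
Proof. by move=> x0; rewrite divr_ge0// subr_ge0 ler_expR; lra. Qed.

Lemma cosh2_sinh2 x : cosh x ^+ 2 - sinh x ^+ 2 = 1.
Proof.
rewrite /cosh /sinh expRN; have := expR_gt0 x; move: (expR x) => y y0.
by field; rewrite gt_eqF.
Qed.

Lemma is_derive_expRN x : is_derive x 1 (fun y => expR (- y)) (- expR (- x)).
Proof.
have := is_derive1_comp (is_derive_expR (- x)) (is_deriveNid x (1 : R)).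
by rewrite mulrN1.
Qed.

Lemma is_derive_cosh x : is_derive x 1 cosh (sinh x).
Proof.
have h := is_derive_expRN x.
have -> : cosh = 2^-1 \*: (expR + (fun y => expR (- y))).
  by apply/funext => t; rewrite /cosh /GRing.scale/= mulrC.
by apply: is_derive_eq; rewrite /sinh /GRing.scale/= mulrC.
Qed.

Lemma is_derive_sinh x : is_derive x 1 sinh (cosh x).
Proof.
have h := is_derive_expRN x.
have -> : sinh = 2^-1 \*: (expR - (fun y => expR (- y))).
  by apply/funext => t; rewrite /sinh /GRing.scale/= mulrC.
by apply: is_derive_eq; rewrite /cosh /GRing.scale/= mulrC opprK.
Qed.

Lemma tanh_ge0 x : 0 <= x -> 0 <= tanh x.
Proof. by move=> x0; rewrite divr_ge0 ?sinh_ge0// ltW// cosh_gt0. Qed.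

Lemma tanhN x : tanh (- x) = - tanh x.
Proof. by rewrite /tanh coshN /sinh opprK -mulNr -mulNr opprB. Qed.

Lemma tanh0 : tanh 0 = 0.
Proof. by rewrite /tanh sinh0 mul0r. Qed.

Lemma tanh_sqr x : 1 - tanh x ^+ 2 = (cosh x ^+ 2)^-1.
Proof.
have c0 : cosh x != 0 by rewrite gt_eqF// cosh_gt0.
apply: (mulIf (expf_neq0 2 c0)); rewrite mulVf ?expf_neq0//.
rewrite mulrBl mul1r -[RHS](cosh2_sinh2 x) /tanh.
by field.
Qed.

Lemma tanh_sqr_le1 x : tanh x ^+ 2 <= 1.
Proof. by rewrite -subr_ge0 tanh_sqr invr_ge0 sqr_ge0. Qed.

Lemma norm_tanh_le1 x : `|tanh x| <= 1.
Proof. by rewrite -(@ler_pXn2r _ 2)// ?nnegrE// expr1n real_normK ?num_real// tanh_sqr_le1. Qed.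

Lemma is_derive_tanh x : is_derive x 1 tanh (1 - tanh x ^+ 2).
Proof.
have c0 : cosh x != 0 by rewrite gt_eqF// cosh_gt0.
have h1 := is_derive_cosh x; have h2 := is_derive_sinh x.
have h3 : is_derive x 1 (fun y => (cosh y)^-1) (- (cosh x) ^- 2 *: sinh x).
  exact: is_deriveV.
have /is_derive_eq := is_deriveM h2 h3; apply.
by rewrite /GRing.scale/= /tanh; field.
Qed.

Lemma continuous_tanh : continuous tanh.
Proof.
move=> x; apply/differentiable_continuous/derivable1_diffP.
by case: (is_derive_tanh x).
Qed.

(** The real power [sech(x)^a], in exponential form so that the power laws reduce to linear
    identities between exponents. *)
Definition sech_pow (a : R) x : R := expR (- (a * ln (cosh x))).

Lemma sech_pow_gt0 a x : 0 < sech_pow a x.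
Proof. exact: expR_gt0. Qed.

Lemma sech_powN a x : sech_pow a (- x) = sech_pow a x.
Proof. by rewrite /sech_pow coshN. Qed.

Lemma sech_pow0 a : sech_pow a 0 = 1.
Proof. by rewrite /sech_pow cosh0 ln1 mulr0 oppr0 expR0. Qed.

Lemma sech_pow_le1 a x : 0 <= a -> sech_pow a x <= 1.
Proof.
move=> a0; rewrite -expR0 ler_expR oppr_le0 mulr_ge0// ln_ge0//.
exact: cosh_ge1.
Qed.

Lemma sech_powR a q x : sech_pow a x `^ q = sech_pow (a * q) x.
Proof.
by rewrite /powR gt_eqF ?sech_pow_gt0// /sech_pow expRK; congr expR; ring.
Qed.

Lemma sech_powD a b x : sech_pow (a + b) x = sech_pow a x * sech_pow b x.
Proof. by rewrite /sech_pow -expRD; congr expR; ring. Qed.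

Lemma sech_pow2 x : sech_pow 2 x = 1 - tanh x ^+ 2.
Proof.
rewrite tanh_sqr /sech_pow expRN; congr (_^-1).
by rewrite -powR_mulrn ?ltW ?cosh_gt0// /powR gt_eqF ?cosh_gt0.
Qed.

Lemma is_derive_sech_pow a x : is_derive x 1 (sech_pow a) (- a * tanh x * sech_pow a x).
Proof.
have h1 := is_derive_cosh x.
have h2 := is_derive1_comp (is_derive1_ln (cosh_gt0 x)) h1.
have h3 : is_derive x 1 ((- a) \*: (@ln R \o cosh)) (- a * ((cosh x)^-1 * sinh x)).
  by apply: is_derive_eq.
have := is_derive1_comp (is_derive_expR _) h3.
have -> : expR \o (- a \*: (@ln R \o cosh)) = sech_pow a.
  by apply/funext => t; rewrite /sech_pow -mulNr.
move=> /is_derive_eq; apply.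
rewrite (_ : expR _ = sech_pow a x); last by rewrite /sech_pow -mulNr.
by rewrite /tanh; ring.
Qed.

Lemma continuous_sech_pow a : continuous (sech_pow a).
Proof.
move=> x; apply/differentiable_continuous/derivable1_diffP.
by case: (is_derive_sech_pow a x).
Qed.

Lemma sech_pow_cvg0 a : 0 < a -> sech_pow a x @[x --> +oo] --> (0 : R).
Proof.
move=> a0; apply: (@cvg_comp _ _ _ (fun x => a * ln (cosh x)) (fun y => expR (- y))); last exact: cvgr_expR.
apply/cvgryPge => A; near=> x.
have x0 : 0 < x by near: x; exact: nbhs_pinfty_gt.
have : expR x / 2 <= cosh x.
  by rewrite ler_pM2r// lerDl expR_ge0.
have e0 : 0 < expR x / 2 by rewrite divr_gt0// expR_gt0.
rewrite -ler_ln ?posrE ?cosh_gt0// ln_div ?posrE ?expR_gt0// expRK => h.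
rewrite mulrC -ler_pdivrMr// (le_trans _ h)// lerBrDr.
by near: x; apply: nbhs_pinfty_ge; rewrite num_real.
Unshelve. all: by end_near. Qed.

End Hyperbolic.

(** * Tail integrals of the soliton profile *)

Section Profile.
Context {R : realType}.
Local Notation leb := (@lebesgue_measure R).

Lemma cvg_sqr (T : Type) (F : set_system T) (FF : Filter F) (f : T -> R) (l : R) :
  f x @[x --> F] --> l -> f x ^+ 2 @[x --> F] --> l ^+ 2.
Proof. by move=> fl; rewrite expr2; under eq_fun do rewrite expr2; exact: cvgM. Qed.

Lemma tail_FTC (f T : R -> R) s : continuous f -> continuous T ->
  (forall x, s <= x -> 0 <= f x) ->
  (forall x : R, s <= x -> is_derive x 1 T (- f x)) -> T x @[x --> +oo] --> (0 : R) ->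
  (\int[leb]_(x in `[s, +oo[) (f x)%:E = (T s)%:E)%E.
Proof.
move=> cf cT f0 dT T0.
have dT' (x : R) : s <= x -> is_derive x 1 (- T) (f x).
  by move=> sx; have h := dT x sx; apply: is_derive_eq; rewrite opprK.
have -> : (T s)%:E = (0%:E - ((- T) s)%:E)%E by rewrite -EFinB sub0r opprK.
apply: ge0_continuous_FTC2y => //.
- exact: continuous_subspaceT.
- by rewrite -oppr0; exact: cvgN.
- by move=> x /ltW sx; case: (dT' x sx).
- by apply: cvg_at_right_filter; apply: cvgN; exact: cT.
- move=> x; rewrite in_itv/= andbT => /ltW sx.
  by rewrite derive1E; have := dT' x sx => dTx; apply: derive_val.
Qed.

Variables (p : R) (p_gt2 : 2 < p).
Variables (M k : R) (M_gt0 : 0 < M) (k_gt0 : 0 < k).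
Local Notation a := (2 / (p - 2)).

Let p_gt0 : 0 < p. Proof. by rewrite (lt_trans _ p_gt2). Qed.
Let a_gt0 : 0 < a. Proof. by rewrite divr_gt0// subr_gt0. Qed.
Let r : R := Num.sqrt (2 / p).
Let r_gt0 : 0 < r. Proof. by rewrite sqrtr_gt0 divr_gt0. Qed.
Let r_sqr : r ^+ 2 = 2 / p. Proof. by rewrite sqr_sqrtr// divr_ge0// ltW. Qed.

Let p2_neq0 : p - 2 != 0. Proof. by rewrite subr_eq0 gt_eqF. Qed.
Let r_neq0 : r != 0. Proof. by rewrite gt_eqF. Qed.
Let k_neq0 : k != 0. Proof. by rewrite gt_eqF. Qed.

(** The exponent [a = 2 / (p - 2)] is the quotient alpha / beta in the formula for the soliton. The
    height [M] and the scale [k] are independent here; [ground_state_parameters] ties them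
    together. *)
Definition profile x : R := M * sech_pow a (k * x).
Definition dprofile x : R := - (a * k) * tanh (k * x) * profile x.
Let v x : R := sech_pow a (k * x).

Let is_derive_scale (f : R -> R) (x d : R) : is_derive (k * x) 1 f d ->
  is_derive x 1 (fun y => f (k * y)) (k * d).
Proof.
move=> fd; have := @is_derive_affine _ f k 0 x d; rewrite subr0 => /(_ fd).
by under eq_fun do rewrite subr0.
Qed.

Let is_derive_v (x : R) : is_derive x 1 v (- (a * k) * tanh (k * x) * v x).
Proof.
have /is_derive_eq := is_derive_scale (is_derive_sech_pow a (k * x)); apply.
by rewrite /v; ring.
Qed.

Lemma is_derive_profile (x : R) : is_derive x 1 profile (dprofile x).
Proof.
have h := is_derive_v x.
have -> : profile = M \*: v by [].
by apply: is_derive_eq; rewrite /GRing.scale/= /dprofile /profile -/(v x); ring.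
Qed.

Let continuous_scale (f : R -> R) : continuous f -> continuous (fun x => f (k * x)).
Proof.
move=> cf x; apply: (@continuous_comp _ _ _ (fun x => k * x) f); last exact: cf.
by apply: cvgM; [exact: cvg_cst|exact: cvg_id].
Qed.

Let continuous_v : continuous v.
Proof. exact: (continuous_scale (@continuous_sech_pow _ _)). Qed.

Lemma continuous_profile : continuous profile.
Proof. by move=> x; apply: cvgM; [exact: cvg_cst|exact: continuous_v]. Qed.

Let continuous_th : continuous (fun x => tanh (k * x)).
Proof. exact: (continuous_scale (@continuous_tanh _)). Qed.

Lemma continuous_dprofile : continuous dprofile.
Proof.
move=> x; apply: cvgM; last exact: continuous_profile.
by apply: cvgM; [exact: cvg_cst|exact: continuous_th].
Qed.

Lemma profile_gt0 x : 0 < profile x.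
Proof. by rewrite mulr_gt0// sech_pow_gt0. Qed.

Lemma profileN x : profile (- x) = profile x.
Proof. by rewrite /profile mulrN sech_powN. Qed.

Lemma dprofileN x : dprofile (- x) = - dprofile x.
Proof. by rewrite /dprofile profileN mulrN tanhN; ring. Qed.

(** The exponent satisfies [a p = 2 a + 2], so the power [p] differs from the square by the factor
    [sech^2 = 1 - tanh^2] alone. *)
Let v_powR x : v x `^ p = v x ^+ 2 * (1 - tanh (k * x) ^+ 2).
Proof.
have E : a * p = a + a + 2 by field; rewrite subr_eq0 gt_eqF.
by rewrite /v sech_powR E (sech_powD (a + a) 2) (sech_powD a a) sech_pow2 expr2.
Qed.

Lemma profile_powR x : profile x `^ p = M `^ (p - 2) * ((1 - tanh (k * x) ^+ 2) * profile x ^+ 2).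
Proof.
rewrite /profile powRM ?ltW ?sech_pow_gt0// -/(v x) v_powR exprMn.
have -> : M `^ p = M `^ (p - 2) * M ^+ 2.
  rewrite -powR_mulrn ?ltW// -powRD ?subrK//.
  by rewrite gt_eqF ?implybT.
ring.
Qed.

(** By [v_powR], [v^2 - v^p = v^2 tanh^2], so the radicand of [potential] is a perfect square;
    [0 <= x] fixes the sign of its root. *)
Let potential_v x : 0 <= x -> potential p (v x) = r * tanh (k * x) * v x.
Proof.
move=> x0; have v0 : 0 < v x := sech_pow_gt0 _ _.
have v1 : v x <= 1 by apply: sech_pow_le1; exact: ltW.
have t0 : 0 <= tanh (k * x) by rewrite tanh_ge0// mulr_ge0// ltW.
apply/eqP; rewrite -(@eqrXn2 _ 2)//; first last.
- exact: (mulr_ge0 (mulr_ge0 (ltW r_gt0) t0) (ltW v0)).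
- exact: potential_ge0.
rewrite potential_sqr// ?gtr0_norm// v_powR !exprMn r_sqr; apply/eqP; ring.
Qed.

Lemma profile_cvg0 : profile x @[x --> +oo] --> (0 : R).
Proof.
rewrite -(mulr0 M); apply: cvgM; first exact: cvg_cst.
apply: (@cvg_comp _ _ _ (fun x => k * x) (sech_pow a)); last exact: sech_pow_cvg0.
by apply: gt0_cvgMry => //; exact: cvg_id.
Qed.

Let v_cvg0 : v x @[x --> +oo] --> (0 : R).
Proof.
apply: (@cvg_comp _ _ _ (fun x => k * x) (sech_pow a)); last exact: sech_pow_cvg0.
by apply: gt0_cvgMry => //; exact: cvg_id.
Qed.

(** By [potential_v], [v' = - (a k / r) W(v)] on [0, +oo[, where W is the potential. Hence [phi'^2 =
    M^2 v'^2 = - (M^2 a k / r) W(v) v'], which [primitive] integrates. *)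
Definition tail_dirichlet s : R := M ^+ 2 * (a * k) / r * primitive p (v s).

Let is_derive_tail_dirichlet (s : R) : 0 <= s ->
  is_derive s 1 tail_dirichlet (- dprofile s ^+ 2).
Proof.
move=> s0.
have h := is_derive1_comp (is_derive_primitive p_gt2 (v s)) (is_derive_v s).
have -> : tail_dirichlet = (M ^+ 2 * (a * k) / r) \*: (primitive p \o v) by [].
apply: is_derive_eq; rewrite /GRing.scale/= potential_v// /dprofile /profile -/(v s).
by field; rewrite ?p2_neq0 ?r_neq0 ?k_neq0.
Qed.

Let continuous_tail_dirichlet : continuous tail_dirichlet.
Proof.
move=> s; apply: cvgM; first exact: cvg_cst.
apply: continuous_comp; first exact: continuous_v.
exact: (continuous_primitive p_gt2).
Qed.

Lemma tail_dirichlet_cvg0 : tail_dirichlet s @[s --> +oo] --> (0 : R).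
Proof.
rewrite -(mulr0 (M ^+ 2 * (a * k) / r)); apply: cvgM; first exact: cvg_cst.
rewrite -(primitive0 p); apply: (@cvg_comp _ _ _ v (primitive p)); first exact: v_cvg0.
exact: (continuous_primitive p_gt2).
Qed.

Lemma integral_dprofile s : 0 <= s ->
  (\int[leb]_(x in `[s, +oo[) (dprofile x ^+ 2)%:E = (tail_dirichlet s)%:E)%E.
Proof.
move=> s0; apply: tail_FTC.
- by move=> x; apply: cvg_sqr; exact: continuous_dprofile.
- exact: continuous_tail_dirichlet.
- by move=> x _; exact: sqr_ge0.
- by move=> x sx; exact: is_derive_tail_dirichlet (le_trans s0 sx).
- exact: tail_dirichlet_cvg0.
Qed.

(* d/dx (tanh * phi^2) = k (1 - tanh^2) phi^2 - 2 a k tanh^2 phi^2, and the last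
   term is a multiple of phi'^2, whose primitive is known. *)
Definition tail_power s : R :=
  2 / (a * k ^+ 2) * tail_dirichlet s - k^-1 * (tanh (k * s) * profile s ^+ 2).

Let is_derive_tail_power (s : R) : 0 <= s ->
  is_derive s 1 tail_power (- ((1 - tanh (k * s) ^+ 2) * profile s ^+ 2)).
Proof.
move=> s0; have h1 := is_derive_tail_dirichlet s0.
have h2 := is_derive_scale (is_derive_tanh (k * s)).
have h3 := is_derive_profile s.
have -> : tail_power = (2 / (a * k ^+ 2)) \*: tail_dirichlet -
    k^-1 \*: ((fun x => tanh (k * x)) * (profile ^+ 2)).
  by apply/funext => x.
apply: is_derive_eq; rewrite /GRing.scale/= expr1 /dprofile.
have -> : (profile ^+ 2) s = profile s ^+ 2 by [].
by field; rewrite ?p2_neq0 ?r_neq0 ?k_neq0.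
Qed.

Lemma tail_power_cvg0 : tail_power s @[s --> +oo] --> (0 : R).
Proof.
rewrite -(subr0 0); apply: cvgB.
  rewrite -(mulr0 (2 / (a * k ^+ 2))); apply: cvgM; first exact: cvg_cst.
  exact: tail_dirichlet_cvg0.
rewrite -(mulr0 k^-1); apply: cvgM; first exact: cvg_cst.
apply/norm_cvg0P.
apply: (@squeeze_cvgr _ _ _ _ (cst 0) (fun s => profile s ^+ 2)).
- near=> s; rewrite normr_ge0/= normrM normrX [`|profile s|]gtr0_norm ?profile_gt0//.
  by rewrite ler_piMl ?sqr_ge0// norm_tanh_le1.
- exact: cvg_cst.
- have -> : 0 = (0 : R) ^+ 2 by rewrite expr0n.
  by apply: cvg_sqr; exact: profile_cvg0.
Unshelve. all: by end_near. Qed.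

Let continuous_tail_power : continuous tail_power.
Proof.
move=> s; apply: cvgB.
  by apply: cvgM; [exact: cvg_cst|exact: continuous_tail_dirichlet].
apply: cvgM; first exact: cvg_cst.
by apply: cvgM; [exact: continuous_th|apply: cvg_sqr; exact: continuous_profile].
Qed.

Let integral_power_part s : 0 <= s ->
  (\int[leb]_(x in `[s, +oo[) ((1 - tanh (k * x) ^+ 2) * profile x ^+ 2)%:E =
   (tail_power s)%:E)%E.
Proof.
move=> s0; apply: tail_FTC.
- move=> x; apply: cvgM; last by apply: cvg_sqr; exact: continuous_profile.
  by apply: cvgB; [exact: cvg_cst|apply: cvg_sqr; exact: continuous_th].
- exact: continuous_tail_power.
- by move=> x _; rewrite mulr_ge0 ?sqr_ge0// subr_ge0 tanh_sqr_le1.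
- by move=> x sx; exact: is_derive_tail_power (le_trans s0 sx).
- exact: tail_power_cvg0.
Qed.

Lemma integral_profile_powR s : 0 <= s ->
  (\int[leb]_(x in `[s, +oo[) (`|profile x| `^ p)%:E =
   (M `^ (p - 2) * tail_power s)%:E)%E.
Proof.
move=> s0; rewrite EFinM -integral_power_part// -ge0_integralZl_EFin//.
- by apply: eq_integral => x _; rewrite gtr0_norm ?profile_gt0// profile_powR EFinM.
- by move=> x _; rewrite lee_fin mulr_ge0 ?sqr_ge0// subr_ge0 tanh_sqr_le1.
- apply/measurable_EFinP; apply: measurable_funTS; apply: continuous_measurable_fun.
  move=> x; apply: cvgM; last by apply: cvg_sqr; exact: continuous_profile.
  by apply: cvgB; [exact: cvg_cst|apply: cvg_sqr; exact: continuous_th].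
- exact: powR_ge0.
Qed.

(** Comes from [1 = (1 - tanh^2) + tanh^2]: the first part of [phi^2] is integrated by [tail_power],
    the second equals [phi'^2 / (a k)^2]. *)
Definition tail_mass s : R := tail_power s + tail_dirichlet s / (a * k) ^+ 2.

Lemma tail_mass_cvg0 : tail_mass s @[s --> +oo] --> (0 : R).
Proof.
rewrite -(addr0 0); apply: cvgD; first exact: tail_power_cvg0.
rewrite -(mul0r ((a * k) ^- 2)); apply: cvgM; last exact: cvg_cst.
exact: tail_dirichlet_cvg0.
Qed.

Lemma integral_profile_sqr s : 0 <= s ->
  (\int[leb]_(x in `[s, +oo[) (profile x ^+ 2)%:E = (tail_mass s)%:E)%E.
Proof.
move=> s0; apply: tail_FTC.
- by move=> x; apply: cvg_sqr; exact: continuous_profile.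
- move=> x; apply: cvgD; first exact: continuous_tail_power.
  by apply: cvgM; [exact: continuous_tail_dirichlet|exact: cvg_cst].
- by move=> x _; exact: sqr_ge0.
- move=> x sx; have h1 := is_derive_tail_power (le_trans s0 sx).
  have h2 := is_derive_tail_dirichlet (le_trans s0 sx).
  have -> : tail_mass = tail_power + ((a * k) ^- 2) \*: tail_dirichlet.
    by apply/funext => y; rewrite /tail_mass mulrC.
  apply: is_derive_eq; rewrite /GRing.scale/= /dprofile.
  by field; rewrite ?p2_neq0 ?r_neq0 ?k_neq0.
- exact: tail_mass_cvg0.
Qed.

End Profile.

(** * Lower bounds on the energy *)

Section IntervalBounds.
Context {R : realType}.
Local Notation leb := (@lebesgue_measure R).
Implicit Types (I : set R) (u : R -> R).

Lemma weak_derivativeP I u : H1 I u ->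
  L2 I (weak_derivative I u) /\ is_weak_derivative I u (weak_derivative I u).
Proof.
move=> [_ _ [g gP]].
by have [] : [set g | L2 I g /\ is_weak_derivative I u g] (weak_derivative I u)
  by apply: getPex; exists g.
Qed.

(** [fine] sends +oo to 0, which breaks equality. The inequality is enough to pass from real
    integrals to extended ones without any integrability. *)
Lemma fine_le_ereal (x : \bar R) : (0 <= x -> (fine x)%:E <= x)%E.
Proof. by case: x => //= r; rewrite lee_fin. Qed.

Lemma measurable_within_comp I (u f : R -> R) : measurable (I : set (measurableTypeR R)) ->
  {within I, continuous u} -> continuous f -> measurable_fun I (f \o u).
Proof.
move=> mI cu cf; apply: subspace_continuous_measurable_fun => //.
have : {within I, continuous (fun t => f (u t))}.
  by move=> t; apply: continuous_comp; [exact: cu|exact: cf].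
by [].
Qed.

Lemma chain_inequality_H1 I u (F f : R -> R) x y : is_interval I -> H1 I u ->
  (forall s : R, is_derive s 1 F (f s)) -> continuous f -> I x -> I y ->
  ((`|F (u y) - F (u x)|%R)%:E <=
   \int[leb]_(t in I) (`|f (u t)| * `|weak_derivative I u t|)%:E)%E.
Proof.
move=> Iitv uH1 dF cf.
have [gI ug] := weak_derivativeP uH1; have [cu _ _] := uH1.
have mI : measurable (I : set (measurableTypeR R)) by exact: is_interval_measurable.
wlog xy : x y / x <= y => [hw|Ix Iy].
  have [xy|/ltW yx] := leP x y; first exact: hw.
  by move=> Ix Iy; rewrite distrC; exact: hw.
have := chain_inequality Iitv cu gI ug dF cf Ix Iy xy; rewrite -lee_fin => /le_trans; apply.
apply: le_trans; first exact/fine_le_ereal/integral_ge0.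
apply: ge0_subset_integral => //.
- apply/measurable_EFinP; apply: measurable_funM.
    apply: measurableT_comp => //.
    apply: subspace_continuous_measurable_fun => // t.
    by apply: continuous_comp; [exact: cu|exact: cf].
  by apply: measurableT_comp => //; case: gI.
- by move=> t /=; rewrite in_itv/=; exact: Iitv.
Qed.

(** The chain inequality for [F t = t ^+ 2], with [2 |u| |g| <= u^2 + g^2], bounds [u ^+ 2] by its
    value at 0 plus the squared H1 norm. *)
Lemma H1_bounded I u : is_interval I -> I 0 -> H1 I u ->
  exists B, forall x, I x -> `|u x| <= B.
Proof.
move=> Iitv I0 uH1; have [gI _] := weak_derivativeP uH1; have [_ uI _] := uH1.
have mI : measurable (I : set (measurableTypeR R)) by exact: is_interval_measurable.
set g := weak_derivative I u in gI.
pose K := fine (\int[leb]_(t in I) ((u t) ^+ 2 + (g t) ^+ 2)%:E)%E.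
have iK : (\int[leb]_(t in I) ((u t) ^+ 2 + (g t) ^+ 2)%:E = K%:E)%E.
  rewrite fineK// integrable_fin_num//.
  exact: (integrableD mI (sqr_integrable uI) (sqr_integrable gI)).
have dsq (s : R) : is_derive s 1 (fun t : R => t ^+ 2) (2 * s).
  have /is_derive_eq := is_deriveX 2 (is_derive_id s (1 : R)); apply.
  by rewrite expr1 /GRing.scale/= mulr1.
have c2 : continuous (fun s : R => 2 * s).
  by move=> s; apply: cvgM; [exact: cvg_cst|exact: cvg_id].
exists (1 + (u 0 ^+ 2 + K)) => x Ix.
apply: le_trans (norm_le_1D_sqr _) _; rewrite lerD2l.
have := chain_inequality_H1 Iitv uH1 dsq c2 I0 Ix.
set J := (X in (_ <= X)%E) => h.
have : (J <= K%:E)%E.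
  rewrite -iK; apply: ge0_le_integral => //.
  - apply/measurable_EFinP; apply: measurable_funM.
      apply: measurableT_comp => //; apply: measurable_funM => //.
      by case: uI.
    by apply: measurableT_comp => //; case: gI.
  - by have /integrableP[] := integrableD mI (sqr_integrable uI) (sqr_integrable gI).
  move=> t _; rewrite lee_fin normrM ger0_norm//.
  rewrite -(real_normK (num_real (u t))) -(real_normK (num_real (g t))).
  rewrite -subr_ge0; have -> : forall a b : R, a ^+ 2 + b ^+ 2 - 2 * a * b = (a - b) ^+ 2.
    by move=> a b; ring.
  exact: sqr_ge0.
move=> /(le_trans h); rewrite lee_fin => /(le_trans (ler_norm _)).
by rewrite lerBlDl.
Qed.

(** Otherwise [u ^+ 2] would be at least [e ^+ 2] on a set of infinite measure. *)
Lemma L2_small_value I (D : set (measurableTypeR R)) u e : measurable (I : set (measurableTypeR R)) ->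
  measurable D -> D `<=` I -> leb D = +oo%E -> L2 I u -> 0 < e ->
  exists2 y, D y & `|u y| < e.
Proof.
move=> mI mD DI Doo [mu uoo] e0; apply: contrapT => hn.
have ue y : D y -> e <= `|u y|.
  by move=> Dy; rewrite leNgt; apply/negP => uy; apply: hn; exists y.
suff : (+oo <= \int[leb]_(x in I) ((u x) ^+ 2)%:E)%E by rewrite leNgt uoo.
have mu2 : measurable_fun I (fun x => ((u x) ^+ 2)%:E).
  by apply/measurable_EFinP; exact: measurable_funX.
apply: (@le_trans _ _ (\int[leb]_(x in D) ((u x) ^+ 2)%:E)%E).
  apply: (@le_trans _ _ (\int[leb]_(x in D) (e ^+ 2)%:E)%E).
    rewrite integral_cst//; move: Doo => /= ->.
    by rewrite gt0_muley// lte_fin exprn_gt0.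
  apply: ge0_le_integral => //.
  - by move=> x _; rewrite lee_fin sqr_ge0.
  - exact: measurable_funS mu2.
  - move=> x Dx; rewrite lee_fin -(real_normK (num_real (u x))).
    by rewrite lerXn2r ?nnegrE ?ue// ltW.
by apply: ge0_subset_integral => // x _; rewrite lee_fin sqr_ge0.
Qed.

Variable p : R.
Hypothesis p_gt2 : 2 < p.
Let p_gt0 : 0 < p. Proof. by rewrite (lt_trans _ p_gt2). Qed.

(** Formally the total variation of [oscillation p M] along [u]. What is used is
    [oscillation_le_cost]: it bounds every difference of two values. *)
Definition oscillation_cost (M : R) I u : \bar R :=
  (\int[leb]_(t in I) (`|potential p (u t / M) / M| * `|weak_derivative I u t|)%:E)%E.

Definition oscillation (M s : R) : R := primitive p (s / M).

Lemma is_derive_oscillation M (s : R) :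
  is_derive s 1 (oscillation M) (potential p (s / M) / M).
Proof.
have /is_derive_eq := @is_derive_affine _ (primitive p) M^-1 0 s _ (is_derive_primitive p_gt2 _).
rewrite subr0 mulrC; under eq_fun do rewrite subr0 mulrC; apply.
by rewrite [M^-1 * s]mulrC.
Qed.

Lemma continuous_doscillation M : continuous (fun s : R => potential p (s / M) / M).
Proof.
have c : continuous (potential p \o (fun s : R => s / M)).
  move=> s; apply: continuous_comp; last exact: (continuous_potential p_gt2).
  by apply: cvgM; [exact: cvg_id|exact: cvg_cst].
by move=> s; apply: cvgM; [exact: c|exact: cvg_cst].
Qed.

Lemma oscillation_le_cost M I u x y : is_interval I -> H1 I u -> I x -> I y ->
  ((`|oscillation M (u y) - oscillation M (u x)|%R)%:E <= oscillation_cost M I u)%E.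
Proof.
move=> Iitv uH1.
exact: (chain_inequality_H1 Iitv uH1 (is_derive_oscillation M) (@continuous_doscillation M)).
Qed.

Lemma oscillation_cost_ge0 M I u : (0 <= oscillation_cost M I u)%E.
Proof. by apply: integral_ge0 => x _; rewrite lee_fin mulr_ge0. Qed.

Lemma dirichlet_ge0 I u : (0 <= dirichlet I u)%E.
Proof. by apply: integral_ge0 => x _; rewrite lee_fin sqr_ge0. Qed.

Lemma mass_ge0 I u : (0 <= mass I u)%E.
Proof. by apply: integral_ge0 => x _; rewrite lee_fin sqr_ge0. Qed.

Lemma Lp_power_ge0 I u : (0 <= Lp_power p I u)%E.
Proof. by apply: integral_ge0 => x _; rewrite lee_fin powR_ge0. Qed.

(* Young's inequality in the form
   [M^(p/2) W(u/M) |u'| <= u'^2/2 + M^p W(u/M)^2/2], for the potential [W]. *)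
Lemma cost_le_energy (M : R) I u : is_interval I -> 0 < M -> H1 I u ->
  (forall x, I x -> `|u x| <= M) ->
  ((M `^ (1 + p / 2))%:E * oscillation_cost M I u + (p^-1)%:E * Lp_power p I u <=
   (2^-1)%:E * dirichlet I u + (p^-1 * M `^ (p - 2))%:E * mass I u)%E.
Proof.
move=> Iitv M0 uH1 uM.
have [gI _] := weak_derivativeP uH1; have [cu [mu _] _] := uH1; have [mg _] := gI.
have mI : measurable (I : set (measurableTypeR R)) by exact: is_interval_measurable.
set g := weak_derivative I u in gI mg *.
pose c t : R := `|potential p (u t / M) / M| * `|g t|.
have c0 t : 0 <= c t by rewrite mulr_ge0.
have mc : measurable_fun I (EFin \o c).
  apply/measurable_EFinP; apply: measurable_funM; last exact: measurableT_comp.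
  apply: measurableT_comp => //.
  exact: (measurable_within_comp mI cu (@continuous_doscillation M)).
have mp : measurable_fun I (fun t => (`|u t| `^ p)%:E).
  apply/measurable_EFinP.
  exact: (measurable_within_comp mI cu (continuous_norm_powR p_gt2)).
have mu2 : measurable_fun I (fun x => ((u x) ^+ 2)%:E).
  by apply/measurable_EFinP; exact: measurable_funX.
have mg2 : measurable_fun I (fun x => ((g x) ^+ 2)%:E).
  by apply/measurable_EFinP; exact: measurable_funX.
have Zl (k : R) f : 0 <= k -> (forall x, 0 <= f x) -> measurable_fun I (fun t => (f t)%:E) ->
    (k%:E * (\int[leb]_(x in I) (f x)%:E) = \int[leb]_(x in I) (k * f x)%:E)%E.
  move=> k0 f0 mf; under [RHS]eq_integral do rewrite EFinM.
  by rewrite ge0_integralZl_EFin// => x _; rewrite lee_fin.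
have Dl (f1 f2 : R -> R) : (forall x, 0 <= f1 x) -> (forall x, 0 <= f2 x) ->
    measurable_fun I f1 -> measurable_fun I f2 ->
    (\int[leb]_(x in I) (f1 x)%:E + \int[leb]_(x in I) (f2 x)%:E =
     \int[leb]_(x in I) (f1 x + f2 x)%:E)%E.
  move=> f10 f20 mf1 mf2; under [RHS]eq_integral do rewrite EFinD.
  by rewrite ge0_integralD//; [move=> x _; rewrite lee_fin|exact/measurable_EFinP|
    move=> x _; rewrite lee_fin|exact/measurable_EFinP].
have K1 : 0 <= M `^ (1 + p / 2) by exact: powR_ge0.
have K2 : 0 <= p^-1 by rewrite invr_ge0 ltW.
have K3 : 0 <= p^-1 * M `^ (p - 2) by rewrite mulr_ge0 ?powR_ge0.
have mZ (k : R) f : measurable_fun I (fun t => (f t)%:E) -> measurable_fun I (fun t => k * f t).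
  by move=> /measurable_EFinP mf; exact: measurable_funM.
rewrite /oscillation_cost /Lp_power /dirichlet /mass -/g.
have g20 x : 0 <= g x ^+ 2 by exact: sqr_ge0.
have u20 x : 0 <= u x ^+ 2 by exact: sqr_ge0.
have up0 x : 0 <= `|u x| `^ p by exact: powR_ge0.
have K4 : 0 <= 2^-1 :> R by [].
rewrite (Zl _ c K1 c0 mc) (Zl _ (fun t => `|u t| `^ p) K2 up0 mp).
rewrite (Zl _ (fun t => g t ^+ 2) K4 g20 mg2) (Zl _ (fun t => u t ^+ 2) K3 u20 mu2).
rewrite Dl; [|by move=> x; rewrite mulr_ge0|by move=> x; rewrite mulr_ge0|exact: mZ|exact: mZ].
rewrite Dl; [|by move=> x; rewrite mulr_ge0|by move=> x; rewrite mulr_ge0|exact: mZ|exact: mZ].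
apply: ge0_le_integral => //.
- by move=> x _; rewrite lee_fin addr_ge0// mulr_ge0.
- by apply/measurable_EFinP; apply: measurable_funD; exact: mZ.
- by apply/measurable_EFinP; apply: measurable_funD; exact: mZ.
move=> x Ix; rewrite lee_fin /c -lerBrDr.
set W := potential p (u x / M).
have W0 : 0 <= W by exact: potential_ge0.
(* The square root in [potential] can be undone only where the modulus of [u] is at most [M]. *)
have uM1 : `|u x / M| <= 1.
  by rewrite normrM normfV (gtr0_norm M0) ler_pdivrMr// mul1r uM.
have W2 : M `^ p * W ^+ 2 = 2 / p * (M `^ (p - 2) * u x ^+ 2 - `|u x| `^ p).
  rewrite /W potential_sqr// normrM normfV (gtr0_norm M0) expr_div_n.
  have -> : (`|u x| / M) `^ p = `|u x| `^ p / M `^ p.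
    rewrite powRM// ?invr_ge0 ?ltW//; congr (_ * _).
    by rewrite -powR_inv1 ?ltW// powRAC powR_inv1// powR_ge0.
  have -> : M `^ p = M `^ (p - 2) * M ^+ 2.
    rewrite -powR_mulrn ?ltW// -powRD ?subrK//.
    by rewrite (gt_eqF M0) implybT.
  field; rewrite ?(gt_eqF M0) ?(gt_eqF p_gt0)//= .
  by rewrite gt_eqF// powR_gt0.
have -> : M `^ (1 + p / 2) * (`|W / M| * `|g x|) = M `^ (p / 2) * W * `|g x|.
  rewrite normrM normfV (gtr0_norm M0) (ger0_norm W0) powRD; last by rewrite (gt_eqF M0) implybT.
  by rewrite powRr1 ?ltW//; field; rewrite (gt_eqF M0).
have Mp : M `^ p = M `^ (p / 2) ^+ 2.
  by rewrite -powR_mulrn ?powR_ge0// -powRrM; congr (_ `^ _); field.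
rewrite -(real_normK (num_real (g x))).
have : 0 <= (M `^ (p / 2) * W - `|g x|) ^+ 2 by exact: sqr_ge0.
rewrite sqrrB exprMn -Mp W2.
set A := M `^ (p / 2) * W * `|g x|; set G := `|g x| ^+ 2.
set U := M `^ (p - 2) * u x ^+ 2; set P := `|u x| `^ p.
have -> : p^-1 * M `^ (p - 2) * u x ^+ 2 = p^-1 * U by rewrite -mulrA.
have -> : 2 / p * (U - P) = 2 * (p^-1 * U) - 2 * (p^-1 * P) by ring.
lra.
Qed.

End IntervalBounds.

(** * The lower bound for a finite family of intervals *)

Section FamilyBound.
Context {R : realType}.
Variable p : R.
Hypothesis p_gt2 : 2 < p.
Let p_gt0 : 0 < p. Proof. by rewrite (lt_trans _ p_gt2). Qed.

Lemma continuous_oscillation (M : R) : continuous (oscillation p M).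
Proof.
move=> s; apply/differentiable_continuous/derivable1_diffP.
by case: (is_derive_oscillation p_gt2 M s).
Qed.

Lemma norm_oscillation (M s : R) : 0 < M -> `|oscillation p M s| = `|oscillation p M `|s| |.
Proof.
move=> M0; rewrite /oscillation norm_primitive//; congr `|primitive p _|.
by rewrite normrM normfV (gtr0_norm M0).
Qed.

Lemma dirichlet_fin_num (I : set R) (u : R -> R) : H1 I u -> dirichlet I u \is a fin_num.
Proof.
move=> uH1; have [[_ goo] _] := weak_derivativeP uH1.
by rewrite ge0_fin_numE// dirichlet_ge0.
Qed.

(** The family stands for the edges of a graph or for a single interval, and [M] is the supremum of
    the modulus of [u]. The geometry enters only through the hypothesis on [oscillation]: [n = 1]
    when [u] comes near 0 somewhere in a connected domain, [n = 2] when it does so on both sides of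
    every point. *)
Lemma family_energy_lower_bound (J : finType) (I : J -> set R) (u : J -> R -> R) (mu n : R) :
  (forall j, is_interval (I j)) -> (forall j, I j 0) -> (forall j, H1 (I j) (u j)) ->
  0 < mu -> (\sum_j mass (I j) (u j) = mu%:E)%E -> 0 <= n ->
  (forall M : R, 0 < M -> (forall j x, I j x -> `|u j x| <= M) -> forall j x, I j x ->
    ((n * `|oscillation p M (u j x)|)%:E <= \sum_j oscillation_cost p M (I j) (u j))%E) ->
  exists2 M : R, 0 < M &
    ((n * primitive p 1 * M `^ (1 + p / 2) - p^-1 * M `^ (p - 2) * mu)%:E <=
     (2^-1)%:E * (\sum_j dirichlet (I j) (u j)) -
     (p^-1)%:E * (\sum_j Lp_power p (I j) (u j)))%E.
Proof.
move=> Iitv I0 uH1 mu0 massE n0 Hosc.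
pose B j : R := sval (cid (H1_bounded (Iitv j) (I0 j) (uH1 j))).
have uB j x : I j x -> `|u j x| <= B j.
  exact: (svalP (cid (H1_bounded (Iitv j) (I0 j) (uH1 j)))).
pose V : set R := [set v | exists j x, I j x /\ v = `|u j x|].
have Vub : has_ubound V.
  exists (\sum_j `|B j|) => _ [j [x [Ix ->]]].
  rewrite (le_trans (uB _ _ Ix))// (le_trans (ler_norm _))//.
  by rewrite (bigD1 j)//= lerDl sumr_ge0.
pose M : R := sup V.
have uM j x : I j x -> `|u j x| <= M by move=> Ix; apply: ub_le_sup => //; exists j, x.
have M0 : 0 < M.
  rewrite ltNge; apply/negP => M0.
  suff : (\sum_j mass (I j) (u j) = 0)%E.
    by rewrite massE => -[] mu00; rewrite mu00 ltxx in mu0.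
  apply: big1 => j _; rewrite /mass (eq_integral (cst 0%E)) ?integral0// => x.
  rewrite inE => Ix.
  have /eqP -> : u j x == 0 by rewrite -normr_le0 (le_trans (uM _ _ Ix)).
  by rewrite expr0n.
(* The supremum of the empty set is 0 by convention, so [0 < M] also shows that [V] is nonempty. *)
have supV : has_sup V.
  split=> //; apply/set0P/negP => /eqP V0.
  by move: M0; rewrite /M V0 sup0 ltxx.
exists M => //.
set C := (\sum_j oscillation_cost p M (I j) (u j))%E in Hosc *.
have kC : ((n * primitive p 1)%:E <= C)%E.
  suff main (e : R) : 0 < e -> ((n * primitive p 1)%:E <= C + e%:E)%E by exact/lee_addgt0Pr.
  move=> e0.
  (* [primitive p 1] is only approached, along values of [u] tending to the supremum. The error is
     multiplied by [n] afterwards, and [n + 1] keeps the divisor positive when [n = 0]. *)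
  have e1 : 0 < e / (n + 1) by rewrite divr_gt0// ltr_wpDl.
  have /cvgrPdist_le/(_ _ e1)/nbhs_ballP[d /= d0 dP] := @continuous_oscillation M M.
  have [v [j [x [Ix vE]]] Mv] := sup_adherent d0 supV.
  have vM : v <= M by rewrite vE; exact: uM.
  have : `|oscillation p M M - oscillation p M v| <= e / (n + 1).
    by apply: dP; rewrite /ball/= ger0_norm ?subr_ge0// -/M in Mv *; lra.
  rewrite {1}/oscillation divff ?gt_eqF// => kv.
  have kv' : primitive p 1 <= `|oscillation p M (u j x)| + e / (n + 1).
    rewrite norm_oscillation// -vE.
    have := ler_normB (oscillation p M v) (oscillation p M v - primitive p 1).
    have := ler_norm (primitive p 1); rewrite [X in _ <= _ + X]distrC subKr.
    by move: kv; lra.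
  have ne : n * (e / (n + 1)) <= e.
    by rewrite mulrCA ler_piMr ?(ltW e0)// ler_pdivrMr ?ltr_wpDl// mul1r; lra.
  have h := Hosc M M0 uM j x Ix.
  apply: (@le_trans _ _ (n * `|oscillation p M (u j x)| + e)%:E); last first.
    by rewrite EFinD; exact: leeD.
  rewrite lee_fin (le_trans (ler_wpM2l n0 kv'))// mulrDr.
  by rewrite lerD2l.
have sum_le : ((M `^ (1 + p / 2))%:E * C + (p^-1)%:E * (\sum_j Lp_power p (I j) (u j)) <=
   (2^-1)%:E * (\sum_j dirichlet (I j) (u j)) + (p^-1 * M `^ (p - 2))%:E * mu%:E)%E.
  rewrite /C -massE !ge0_sume_distrr; first last.
  - by move=> j _; exact: oscillation_cost_ge0.
  - by move=> j _; exact: Lp_power_ge0.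
  - by move=> j _; exact: dirichlet_ge0.
  - by move=> j _; exact: mass_ge0.
  rewrite -!big_split/=; apply: lee_sum => j _.
  by apply: cost_le_energy => //; exact: uM.
have Dfin : (\sum_j dirichlet (I j) (u j))%E \is a fin_num.
  by apply/sum_fin_numP => j _ _; exact: dirichlet_fin_num.
have C0 : (0 <= C)%E by apply: sume_ge0 => j _; exact: oscillation_cost_ge0.
have P0 : (0 <= \sum_j Lp_power p (I j) (u j))%E.
  by apply: sume_ge0 => j _; exact: Lp_power_ge0.
have K1 : 0 < M `^ (1 + p / 2) by exact: powR_gt0.
have K2 : 0 < p^-1 by rewrite invr_gt0.
move: Dfin kC sum_le C0 P0.
move: (\sum_j dirichlet (I j) (u j))%E => D; move: (\sum_j Lp_power p (I j) (u j))%E => P.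
case: D => [D||]// _; case: C {Hosc} => [c| |]// kC; case: P => [P| |]//.
- rewrite lee_fin in kC; rewrite -!EFinM -EFinN -!EFinD !lee_fin => h _ _.
  have := ler_wpM2r (ltW K1) kC; lra.
(* The right side of [sum_le] is finite, so an infinite cost or an infinite power term contradicts
   it. *)
- by rewrite gt0_muley ?lte_fin// -EFinM addey// -!EFinM -EFinD.
- by rewrite gt0_muley ?lte_fin// -!EFinM addye// -EFinD.
- by rewrite !gt0_muley ?lte_fin// -!EFinM -EFinD.
Qed.

End FamilyBound.

(** * Oscillation along paths of edges *)

Section LineGraph.
Context {R : realType} (G : metric_graph R).
Implicit Types (e f : edge G) (v w : vertex G).

Definition incident v e : bool := (source e == v) || (target e == v).

(** Paths run through edges instead of vertices, because a function on the graph is indexed by edges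
    and each edge carries one cost. *)
Definition edge_adj : rel (edge G) :=
  fun e f => [exists v, incident v e && incident v f].

Lemma edge_adj_connected e f : connect edge_adj e f.
Proof.
suff path_connected v (q : seq (vertex G)) e1 e2 : path (@graph_adj R G) v q ->
    incident v e1 -> incident (last v q) e2 -> connect edge_adj e1 e2.
  have /connectP[q vq E] := metric_graph_connected (source e) (source f).
  apply: (path_connected _ _ _ _ vq); first by rewrite /incident eqxx.
  by rewrite -E /incident eqxx.
elim: q v e1 => [|w q IH] v e1 /=.
  by move=> _ i1 i2; apply: connect1; apply/existsP; exists v; rewrite i1.
move=> /andP[/existsP[e' /orP ve'w] wq] i1 i2.
have i' : incident v e' /\ incident w e'.
  by rewrite /incident; case: ve'w => /andP[-> ->]; rewrite ?orbT.
apply: (@connect_trans _ _ e'); last by apply: (IH w) => //; case: i'.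
by apply: connect1; apply/existsP; exists v; rewrite i1/=; case: i'.
Qed.

(** [glued] leaves the values at infinity free, so a path crossing a vertex at infinity would lose
    continuity. Degree one excludes this: [e] already accounts for the whole degree of its
    target. *)
Lemma half_line_unique v e f : is_half_line e -> target e = v -> incident v f -> f = e.
Proof.
move=> he tv iv; have vinf : at_infinity v by apply/existsP; exists e; rewrite he tv eqxx.
have := degree_at_infinity vinf; rewrite /degree => deg.
have c1 : (0 < #|[pred e | target e == v]|)%N.
  by apply/card_gt0P; exists e; rewrite inE tv.
have tv1 : #|[pred e | target e == v]| = 1%N by lia.
have sv0 : #|[pred e | source e == v]| = 0%N by lia.
move: iv; rewrite /incident => /orP[sf|tf].
  by have := card0_eq sv0 f; rewrite !inE sf.
have /card1P[e' he'] : #|[pred e | target e == v]| == 1%N by rewrite tv1.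
have := he' e; have := he' f; rewrite !inE tv eqxx tf => /esym/eqP -> /esym/eqP ->.
by [].
Qed.

Lemma edge_interval_is_interval e : is_interval (edge_interval e).
Proof. by rewrite /edge_interval; case: (edge_length e) => [l||]; exact: interval_is_interval. Qed.

Lemma edge_interval0 e : edge_interval e 0.
Proof.
rewrite /edge_interval; have := edge_length_gt0 e.
case: (edge_length e) => [l||]; rewrite /half_line /= in_itv/= ?lexx//.
by rewrite lte_fin => /ltW.
Qed.

(* A vertex at infinity is given the value at the other end of its half-line. *)
Lemma glued_vertex_values (u : edge G -> R -> R) : glued u ->
  exists w : vertex G -> R, forall e v, incident v e ->
    exists2 x, edge_interval e x & u e x = w v.
Proof.
move=> [w uw].
exists (fun v => if [pick e | is_half_line e && (target e == v)] is Some e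
                 then w (source e) else w v) => e v ev.
case: pickP => [f /andP[hf /eqP tf]|nohalf].
  rewrite (half_line_unique hf tf ev); exists 0; first exact: edge_interval0.
  by have [-> _] := uw f.
move: ev; rewrite /incident => /orP[/eqP <-|/eqP te].
  by exists 0; [exact: edge_interval0|have [-> _] := uw e].
have := nohalf e; rewrite te eqxx andbT => eh.
have [_ ul] := uw e.
move: ul (edge_length_gt0 e) eh; rewrite /edge_interval /is_half_line.
case: (edge_length e) => [l||]//= ul l0 _.
exists l; first by rewrite /= in_itv/= lexx andbT; exact: ltW.
by rewrite ul// te.
Qed.

(** The differences telescope along a path, since consecutive edges share a vertex value. Shortening
    the path to one without repetition makes each edge count at most once, and the costs of the
    other edges are nonnegative. *)
Lemma graph_oscillation (u : edge G -> R -> R) (h : R -> R) (c : edge G -> R) :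
  glued u ->
  (forall e x y, edge_interval e x -> edge_interval e y -> `|h (u e x) - h (u e y)| <= c e) ->
  forall e f x y, edge_interval e x -> edge_interval f y ->
  `|h (u e x) - h (u f y)| <= \sum_e c e.
Proof.
move=> /glued_vertex_values[w uw] hc.
have c0 e : 0 <= c e.
  by apply: le_trans (hc e 0 0 _ _); rewrite ?subrr ?normr0//; exact: edge_interval0.
have along (q : seq (edge G)) e x y : path edge_adj e q -> edge_interval e x ->
    edge_interval (last e q) y ->
    `|h (u e x) - h (u (last e q) y)| <= \sum_(f <- e :: q) c f.
  elim: q e x => [|f q IH] e x /=.
    by move=> _ ex ey; rewrite big_seq1; exact: hc.
  move=> /andP[/existsP[v /andP[/uw[z ez zv] /uw[t ft tv]]] fq] ex ly.
  rewrite big_cons -(subrKA (h (u e z))) (le_trans (ler_normD _ _))// lerD//; first exact: hc.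
  by rewrite zv -tv; exact: IH.
move=> e f x y ex fy.
have /connectP[q0 eq0 E] := edge_adj_connected e f.
move: E fy; case: (shortenP eq0) => q eq uq _ -> fy.
apply: le_trans (along _ _ _ _ eq ex fy) _.
rewrite big_uniq//= [leRHS](bigID (mem (e :: q)))/= lerDl.
by apply: sumr_ge0 => i _.
Qed.

End LineGraph.

(** * Lower bounds on the graph, the half-line and the line *)

Section LowerBounds.
Context {R : realType}.
Local Notation leb := (@lebesgue_measure R).
Variable p : R.
Hypothesis p_gt2 : 2 < p.
Let p_gt0 : 0 < p. Proof. by rewrite (lt_trans _ p_gt2). Qed.

(* The lower bound on the energy of a function of mass [mu] with maximal modulus
   [M] whose modulus goes [n] times through all the values between 0 and [M]. *)
Definition energy_profile (n mu M : R) : R :=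
  n * primitive p 1 * M `^ (1 + p / 2) - p^-1 * M `^ (p - 2) * mu.

Lemma small_oscillation (M : R) (I D : set R) (u : R -> R) (e : R) : is_interval I ->
  measurable (D : set (measurableTypeR R)) -> D `<=` I -> leb D = +oo%E -> H1 I u -> 0 < e ->
  exists2 y, D y & `|oscillation p M (u y)| <= e.
Proof.
move=> Iitv mD DI Doo [_ uI _] e0.
have mI : measurable (I : set (measurableTypeR R)) by exact: is_interval_measurable.
have /cvgrPdist_le/(_ _ e0)/nbhs_ballP[d /= d0 dP] := @continuous_oscillation _ _ p_gt2 M 0.
have [y Dy yd] := L2_small_value mI mD DI Doo uI d0.
exists y => //; have := dP (u y); rewrite /ball/= sub0r normrN => /(_ yd).
by rewrite {1}/oscillation mul0r primitive0 sub0r normrN.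
Qed.

Lemma half_line_is_interval : is_interval (@half_line R).
Proof. exact: interval_is_interval. Qed.

Lemma measurable_half_line : measurable (half_line : set (measurableTypeR R)).
Proof. exact: measurable_itv. Qed.

Lemma lebesgue_measure_half_line : leb half_line = +oo%E.
Proof. by rewrite /half_line lebesgue_measure_itv/= ltry. Qed.

(** Here [n = 1]: each value of the oscillation is compared, through [graph_oscillation], with a
    value close to 0 on the half-line [e0]. *)
Lemma graph_lower_bound (G : metric_graph R) (u : edge G -> R -> R) (mu : R) :
  (exists e : edge G, is_half_line e) -> 0 < mu -> graph_H1_mass G mu u ->
  exists2 M, 0 < M & ((energy_profile 1 mu M)%:E <= graph_energy p u)%E.
Proof.
move=> [e0 he0] mu0 [[gu uH1] massE].
apply: family_energy_lower_bound => //.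
- exact: edge_interval_is_interval.
- exact: edge_interval0.
move=> M M0 _ e x ex; rewrite mul1r.
set C := (\sum_j _)%E.
have C0 : (0 <= C)%E by apply: sume_ge0 => j _; exact: oscillation_cost_ge0.
(* An infinite total cost makes the bound trivial; otherwise every edge has a finite cost and real
   arithmetic applies. *)
have [Coo|Cfin] := eqVneq C +oo%E; first by rewrite Coo leey.
have costfin j : oscillation_cost p M (edge_interval j) (u j) \is a fin_num.
  have Cf : C \is a fin_num by rewrite ge0_fin_numE// lt_neqAle Cfin leey.
  by move/sum_fin_numP : Cf; apply => //; rewrite mem_index_enum.
apply/lee_addgt0Pr; suff main (d : R) : 0 < d ->
  ((`|oscillation p M (u e x)|)%:E <= C + d%:E)%E by exact: main.
move=> d0.
have e0E : edge_interval e0 = half_line.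
  by rewrite /edge_interval; move: he0; rewrite /is_half_line => /eqP ->.
have [y ey uy] : exists2 y, edge_interval e0 y & `|oscillation p M (u e0 y)| <= d.
  have h := uH1 e0; rewrite e0E in h *.
  exact: (small_oscillation M half_line_is_interval measurable_half_line (fun _ => id)
    lebesgue_measure_half_line h d0).
pose c j := fine (oscillation_cost p M (edge_interval j) (u j)).
have CE : C = (\sum_j c j)%:E.
  by rewrite -sumEFin; apply: eq_bigr => j _; rewrite fineK.
have := @graph_oscillation _ G u (oscillation p M) c gu.
have hc j s t : edge_interval j s -> edge_interval j t ->
    `|oscillation p M (u j s) - oscillation p M (u j t)| <= c j.
  move=> js jt; rewrite -lee_fin fineK//.
  by apply: oscillation_le_cost => //; exact: edge_interval_is_interval.
move=> /(_ hc e e0 x y ex ey) h.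
rewrite CE -EFinD lee_fin -(subrK (oscillation p M (u e0 y)) (oscillation p M (u e x))).
by rewrite (le_trans (ler_normD _ _))// lerD.
Qed.

Lemma interval_lower_bound (I : set R) (u : R -> R) (mu n : R) :
  is_interval I -> I 0 -> 0 < mu -> 0 <= n -> H1_mass I mu u ->
  (forall M : R, 0 < M -> forall x, I x ->
    ((n * `|oscillation p M (u x)|)%:E <= oscillation_cost p M I u)%E) ->
  exists2 M, 0 < M & ((energy_profile n mu M)%:E <= energy p I u)%E.
Proof.
move=> Iitv I0 mu0 n0 [uH1 massE] Hosc.
have := @family_energy_lower_bound R p p_gt2 'I_1 (fun=> I) (fun=> u) mu n.
rewrite !big_ord1; apply => //.
by move=> M M0 _ _ x Ix; rewrite big_ord1; exact: Hosc.
Qed.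

Lemma half_line_lower_bound (u : R -> R) (mu : R) : 0 < mu -> H1_mass half_line mu u ->
  exists2 M, 0 < M & ((energy_profile 1 mu M)%:E <= energy p half_line u)%E.
Proof.
move=> mu0 uH; have hitv := half_line_is_interval.
apply: interval_lower_bound => //; first by rewrite /half_line /= in_itv/= lexx.
move=> M M0 x Ix; rewrite mul1r; have [uH1 _] := uH.
apply/lee_addgt0Pr; suff main (d : R) : 0 < d ->
  ((`|oscillation p M (u x)|)%:E <= oscillation_cost p M half_line u + d%:E)%E by exact: main.
move=> d0.
have [y ey uy] : exists2 y, half_line y & `|oscillation p M (u y)| <= d.
  exact: (small_oscillation M half_line_is_interval measurable_half_line (fun _ => id)
    lebesgue_measure_half_line uH1 d0).
have := oscillation_le_cost p_gt2 M hitv uH1 ey Ix => h.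
apply: le_trans (leeD h (_ : (d%:E <= d%:E)%E)) => //.
rewrite -EFinD lee_fin -[X in `|X| <= _](subrK (oscillation p M (u y))).
by rewrite (le_trans (ler_normD _ _))// lerD2l.
Qed.

Let two_sided_bound (a b1 b2 c1 c2 A B d : R) : a <= b1 + c1 -> b1 <= A -> c1 <= d / 2 ->
  a <= b2 + c2 -> b2 <= B -> c2 <= d / 2 -> 2 * a <= A + B + d.
Proof. by lra. Qed.

(** Here [n = 2]: [u] is nearly 0 at some [y] left of [x] and at some [z] right of it, and the costs
    over [y, x] and [x, z] add up. *)
Lemma line_lower_bound (u : R -> R) (mu : R) : 0 < mu -> H1_mass [set: R] mu u ->
  exists2 M, 0 < M & ((energy_profile 2 mu M)%:E <= energy p [set: R] u)%E.
Proof.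
move=> mu0 uH; have Titv : is_interval [set: R] by [].
apply: interval_lower_bound => // M M0 x _; have [uH1 _] := uH.
have [cu _ _] := uH1; have [gI ug] := weak_derivativeP uH1.
apply/lee_addgt0Pr; suff main (d : R) : 0 < d ->
  ((2 * `|oscillation p M (u x)|)%:E <= oscillation_cost p M [set: R] u + d%:E)%E by exact: main.
move=> d0; have d2 : 0 < d / 2 by rewrite divr_gt0.
have [y yx uy] : exists2 y, `]-oo, x]%classic y & `|oscillation p M (u y)| <= d / 2.
  by apply: (@small_oscillation M [set: R] _ u _ Titv _ _ _ uH1 d2) => //; rewrite lebesgue_measure_itv/= ?ltNyr ?ltry.
have [z xz uz] : exists2 z, `[x, +oo[%classic z & `|oscillation p M (u z)| <= d / 2.
  by apply: (@small_oscillation M [set: R] _ u _ Titv _ _ _ uH1 d2) => //; rewrite lebesgue_measure_itv/= ?ltNyr ?ltry.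
rewrite /= in_itv/= in yx; rewrite /= in_itv/= andbT in xz.
have dosc := is_derive_oscillation p_gt2 M.
have cosc := @continuous_doscillation _ _ p_gt2 M.
have h1 := chain_inequality Titv cu gI ug dosc cosc I I yx.
have h2 := chain_inequality Titv cu gI ug dosc cosc I I xz.
pose w (t : R) : R := `|potential p (u t / M) / M| * `|weak_derivative [set: R] u t|.
rewrite -/w in h1 h2.
have mw : measurable_fun [set: R] w.
  apply: measurable_funM; last by apply: measurableT_comp => //; case: gI.
  by apply: measurableT_comp => //; exact: (measurable_within_comp _ cu cosc).
have w0 t : 0 <= w t by rewrite mulr_ge0.
have h : ((\int[leb]_(t in `[y, x]) w t + \int[leb]_(t in `[x, z]) w t)%:E <=
    oscillation_cost p M [set: R] u)%E.
  rewrite EFinD; apply: le_trans.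
    by apply: leeD; apply/fine_le_ereal/integral_ge0 => t _; rewrite lee_fin.
  (* Removing the endpoint [x] from the first interval leaves its integral unchanged and makes the
     two domains disjoint. *)
  rewrite -[X in (X + _)%E]integral_itv_bndo_bndc; last first.
    by apply/measurable_EFinP; exact: measurable_funTS.
  have mA : measurable (`[y, x[ : set (measurableTypeR R)) by [].
  have mB : measurable (`[x, z] : set (measurableTypeR R)) by [].
  have mwE (D : set (measurableTypeR R)) : measurable_fun D (fun t : measurableTypeR R => (w t)%:E).
    by apply/measurable_EFinP; exact: measurable_funTS.
  have wE (D : set R) t : D t -> (0 <= (w t)%:E)%E by move=> _; rewrite lee_fin.
  have dis : [disjoint `[y, x[%classic & `[x, z]%classic].
    apply/disj_setPS => t [] /=; rewrite !in_itv/= => /andP[_ tx] /andP[xt _].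
    by have := lt_le_trans tx xt; rewrite ltxx.
  rewrite -(ge0_integral_setU leb mA mB (mwE _) (wE _) dis).
  have mAB : measurable (`[y, x[ `|` `[x, z] : set (measurableTypeR R)) by exact: measurableU.
  have mT : measurable ([set: R] : set (measurableTypeR R)) by [].
  exact: (ge0_subset_integral leb mAB mT (mwE _) (wE _) (@subsetT _ _)).
apply: le_trans (leeD h (_ : (d%:E <= d%:E)%E)) => //.
rewrite -EFinD lee_fin.
have tri (a b : R) : `|a| <= `|a - b| + `|b| by rewrite -[in leLHS](subrK b a) ler_normD.
have t1 := tri (oscillation p M (u x)) (oscillation p M (u y)).
have t2 := tri (oscillation p M (u x)) (oscillation p M (u z)); rewrite distrC in t2.
exact: two_sided_bound t1 h1 uy t2 h2 uz.
Qed.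

End LowerBounds.

(** * The ground state and the upper bound *)

Section GroundState.
Context {R : realType}.
Local Notation leb := (@lebesgue_measure R).
Variable p : R.
Hypotheses (p_gt2 : 2 < p) (p_lt6 : p < 6).
Let p_gt0 : 0 < p. Proof. by rewrite (lt_trans _ p_gt2). Qed.
Let p2_gt0 : 0 < p - 2. Proof. by rewrite subr_gt0. Qed.
Local Notation a := (2 / (p - 2)).
Local Notation kappa := (primitive p 1).

Let kappa_gt0 : 0 < kappa. Proof. exact: primitive1_gt0. Qed.

(* Weighted AM-GM: [t <= t^q / q + 1 - 1/q] for [q = (p + 2) / (2 (p - 2)) > 1]. *)
Lemma energy_profile_min (mu M N : R) : 0 < M -> 0 < N ->
  p^-1 * M `^ (p - 2) * mu = (p + 2) / (2 * (p - 2)) * (kappa * M `^ (1 + p / 2)) ->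
  energy_profile p 1 mu M <= energy_profile p 1 mu N.
Proof.
move=> M0 N0 crit.
pose q := (p + 2) / (2 * (p - 2)).
have q1 : 1 < q.
  have h : 0 < 2 * (p - 2) by rewrite mulr_gt0.
  by rewrite /q ltr_pdivlMr//; move: p_lt6; lra.
have q0 : 0 < q by rewrite (lt_trans _ q1).
pose A := kappa * M `^ (1 + p / 2).
have A0 : 0 < A by rewrite mulr_gt0// powR_gt0.
pose t := (N / M) `^ (p - 2).
have NM : 0 < N / M by rewrite divr_gt0.
have NE : N = N / M * M by rewrite divfK// gt_eqF.
have E1 : p^-1 * N `^ (p - 2) * mu = q * A * t.
  rewrite [in LHS]NE powRM ?(ltW NM) ?(ltW M0)// -/t.
  by transitivity (p^-1 * M `^ (p - 2) * mu * t); [ring|rewrite crit].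
have E2 : kappa * N `^ (1 + p / 2) = A * t `^ q.
  rewrite [in LHS]NE powRM ?(ltW NM) ?(ltW M0)// /t -powRrM /A.
  have -> : (p - 2) * q = 1 + p / 2 by rewrite /q; field; rewrite gt_eqF.
  ring.
have young : t <= t `^ q / q + (1 - q^-1).
  have := @conjugate_powR _ t 1 q (1 - q^-1)^-1 (powR_ge0 _ _) ler01 q0.
  rewrite powR1 div1r mulr1 invrK; apply; last by rewrite addrC subrK.
  by rewrite invr_gt0 subr_gt0 invf_lt1.
rewrite /energy_profile !mul1r E1 E2 crit -/A -/q.
rewrite -(ler_pM2l (mulr_gt0 A0 q0)) in young.
have : A * q * (t `^ q / q + (1 - q^-1)) = A * t `^ q + A * q - A by field; rewrite gt_eqF.
by move: young => /[swap] -> ?; lra.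
Qed.

(** For the bounds, the line at mass [mu] amounts to two half-lines at mass [mu / 2]. This is the
    origin of the factor 1/2 and of the mass [2 * mu] in the half-line minimum. *)
Lemma energy_profile2 (mu M : R) : energy_profile p 2 mu M = 2 * energy_profile p 1 (mu / 2) M.
Proof. by rewrite /energy_profile; field; rewrite gt_eqF. Qed.

(** [M] is the stationary point of [energy_profile], and [k] is the scale at which the profile gives
    equality in Young's inequality. With both choices the mass comes out as [mu] and the energy as
    the lower bound. *)
Lemma ground_state_parameters (mu : R) : 0 < mu -> exists M k : R,
  [/\ 0 < M, 0 < k, tail_mass p M k 0 = mu &
    2^-1 * tail_dirichlet p M k 0 - p^-1 * (M `^ (p - 2) * tail_power p M k 0) =
      energy_profile p 1 mu M /\
    forall N, 0 < N -> energy_profile p 1 mu M <= energy_profile p 1 mu N].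
Proof.
move=> mu0.
(* Setting the derivative of [energy_profile p 1 mu] to 0 gives [M^((6 - p) / 2) = X], solvable
   because [p < 6]. *)
pose X := mu * (2 * (p - 2)) / (p * (p + 2) * kappa).
have pp2 : 0 < p + 2 by rewrite addr_gt0.
have X0 : 0 < X.
  exact: (divr_gt0 (mulr_gt0 mu0 (mulr_gt0 (ltr0Sn _ 1) p2_gt0))
    (mulr_gt0 (mulr_gt0 p_gt0 pp2) kappa_gt0)).
pose M := X `^ (2 / (6 - p)).
have M0 : 0 < M by exact: powR_gt0.
have MX : M `^ (1 + p / 2) = M `^ (p - 2) * X.
  have -> : 1 + p / 2 = (p - 2) + (6 - p) / 2 by field.
  rewrite powRD ?(gt_eqF M0) ?implybT//; congr (_ * _).
  rewrite /M -powRrM.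
  have -> : 2 / (6 - p) * ((6 - p) / 2) = 1 by field; rewrite subr_eq0 gt_eqF.
  by rewrite powRr1// ltW.
have crit : p^-1 * M `^ (p - 2) * mu = (p + 2) / (2 * (p - 2)) * (kappa * M `^ (1 + p / 2)).
  rewrite MX /X; field.
  by rewrite !gt_eqF.
pose r := Num.sqrt (2 / p).
have r0 : 0 < r by rewrite sqrtr_gt0 divr_gt0.
have r2 : r ^+ 2 = 2 / p by rewrite sqr_sqrtr// divr_ge0// ltW.
(* On [0, +oo[ the profile satisfies [phi' = - (a k M / r) W(phi / M)], where W is the potential.
   Equality in Young's inequality requires the factor to be [M^(p/2)]. *)
pose k := r * M `^ ((p - 2) / 2) / a.
have a0 : 0 < a by rewrite divr_gt0.
have k0 : 0 < k by rewrite !mulr_gt0// ?powR_gt0// invr_gt0.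
have ak : a * k = r * M `^ ((p - 2) / 2) by rewrite /k mulrC divfK// gt_eqF.
have Mp2 : M `^ ((p - 2) / 2) ^+ 2 = M `^ (p - 2).
  have half : (p - 2) / 2 + (p - 2) / 2 = p - 2 by field.
  by rewrite expr2 -powRD ?half// (gt_eqF M0) implybT.
have ak2 : (a * k) ^+ 2 = 2 / p * M `^ (p - 2) by rewrite ak exprMn r2 Mp2.
have dir0 : tail_dirichlet p M k 0 = kappa * M `^ (1 + p / 2).
  rewrite /tail_dirichlet mulr0 sech_pow0 ak -/r.
  have -> : M `^ (1 + p / 2) = M ^+ 2 * M `^ ((p - 2) / 2).
    rewrite -(powR_mulrn 2 (ltW M0)) -powRD ?(gt_eqF M0) ?implybT//.
    by congr (_ `^ _); field.
  by field; rewrite gt_eqF.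
have pow0 : tail_power p M k 0 = 2 * a / (2 / p * M `^ (p - 2)) * (kappa * M `^ (1 + p / 2)).
  rewrite /tail_power dir0 mulr0 tanh0 mul0r mulr0 subr0 -ak2.
  by congr (_ * _); field; rewrite ?(gt_eqF k0) ?(gt_eqF p2_gt0).
have Mp0 : 0 < M `^ (p - 2) by exact: powR_gt0.
exists M, k; split=> //.
- rewrite /tail_mass pow0 dir0 ak2.
  have -> : mu = (p + 2) / (2 * (p - 2)) * (kappa * M `^ (1 + p / 2)) * p / M `^ (p - 2).
    by rewrite -crit; field; rewrite !gt_eqF.
  by field; rewrite !gt_eqF.
- split; last by move=> N N0; exact: energy_profile_min.
  rewrite /energy_profile dir0 pow0 crit mul1r.
  by field; rewrite !gt_eqF.
Qed.

End GroundState.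

(** * Integrals of even and of shifted functions *)

Section Even.
Context {R : realType}.
Local Notation leb := (@lebesgue_measure R).
Implicit Types (f : R -> R) (s : R).

Lemma even_integral_line f (t : R) : continuous f -> (forall x, 0 <= f x) ->
  (forall x, f (- x) = f x) ->
  (\int[leb]_(x in half_line) (f x)%:E = t%:E)%E ->
  (\int[leb]_x (f x)%:E = (2 * t)%:E)%E.
Proof.
move=> cf f0 ef ft; rewrite ge0_symfun_integralT//.
  have -> : [set x : R | 0 <= x] = half_line.
    by apply/seteqP; split => x; rewrite /half_line /= in_itv/= andbT.
  by rewrite ft EFinM.
by move=> x /=; rewrite ef.
Qed.

(** By evenness, the part left of [- s] has the integral of the right tail. This evaluates a bump
    centered at distance [s] from the end of a half-line. *)
Lemma even_integral_shifted_line f (s t ts : R) : continuous f -> (forall x, 0 <= f x) ->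
  (forall x, f (- x) = f x) ->
  (\int[leb]_x (f x)%:E = t%:E)%E ->
  (\int[leb]_(x in `[s, +oo[) (f x)%:E = ts%:E)%E ->
  (\int[leb]_(x in `[(- s)%R, +oo[) (f x)%:E = (t - ts)%:E)%E.
Proof.
move=> cf f0 ef tE tsE.
have mf (D : set (measurableTypeR R)) : measurable_fun D (fun x : measurableTypeR R => (f x)%:E).
  by apply/measurable_EFinP; apply: measurable_funTS; exact: continuous_measurable_fun.
have fE (D : set (measurableTypeR R)) x : D x -> (0 <= (f x)%:E)%E by move=> _; rewrite lee_fin.
have left : (\int[leb]_(x in `]-oo, (- s)%R[) (f x)%:E = ts%:E)%E.
  rewrite integral_itv_bndo_bndc; last exact: mf.
  rewrite ge0_integration_by_substitutionNy//; last exact: continuous_subspaceT.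
  by rewrite -tsE; apply: eq_integral => x _ /=; rewrite ef.
have dis : [disjoint `]-oo, (- s)%R[%classic & `[(- s)%R, +oo[%classic].
  apply/disj_setPS => x [] /=; rewrite !in_itv/= andbT => xs sx.
  by have := lt_le_trans xs sx; rewrite ltxx.
have mA : measurable (`]-oo, (- s)%R[ : set (measurableTypeR R)) by [].
have mB : measurable (`[(- s)%R, +oo[ : set (measurableTypeR R)) by [].
have := ge0_integral_setU leb mA mB (mf _) (@fE _) dis.
have -> : `]-oo, (- s)%R[ `|` `[(- s)%R, +oo[ = [set: R].
  rewrite -subTset => x _ /=; rewrite !in_itv/= andbT.
  by have [xs|sx] := ltP x (- s); [left|right].
rewrite tE left => E.
have /(congr1 (fun z => z - ts%:E)%E) := E.
by rewrite addeAC subee// add0e -EFinB => ->.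
Qed.

Lemma integral_half_line_shift f (s : R) : continuous f -> (forall x, 0 <= f x) ->
  (\int[leb]_(x in half_line) (f (x + s))%:E = \int[leb]_(x in `[s, +oo[) (f x)%:E)%E.
Proof.
move=> cf f0.
have dF (x : R) : is_derive x 1 (fun x : R => x + s) 1.
  have /is_derive_eq := is_deriveD (is_derive_id x (1 : R)) (is_derive_cst s x (1 : R)).
  by apply; rewrite addr0.
have F1 : derive1 (fun x : R => x + s) = cst 1.
  by apply/funext => x; rewrite derive1E; apply: derive_val.
have := @increasing_ge0_integration_by_substitutiony R (fun x => x + s) f 0.
rewrite F1 add0r => ->.
- by apply: eq_integral => x _; rewrite /GRing.mul/= mulr1.
- by move=> x y _ _; rewrite ltrD2r.
- by move=> x _; exact: cst_continuous.
- exact: is_cvg_cst.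
- exact: is_cvg_cst.
- split; first by move=> x _; case: (dF x).
  apply: cvg_at_right_filter; apply: cvgD; [exact: cvg_id|exact: cvg_cst].
- apply/cvgryPge => A; near=> x; rewrite -lerBlDr.
  by near: x; apply: nbhs_pinfty_ge; rewrite num_real.
- exact: continuous_subspaceT.
- by move=> x _.
Unshelve. all: by end_near. Qed.

End Even.

(** * C^1 functions as elements of H1 *)

Section SmoothFunctions.
Context {R : realType}.
Local Notation leb := (@lebesgue_measure R).
Implicit Types (I : set R) (w dw : R -> R).

(** Packages the countable cover by segments on which [weak_derivative_unique] relies. *)
Definition exhausted I := exists c d : nat -> R,
  (forall n, I (c n) /\ I (d n)) /\ (forall x, I x -> exists n, c n <= x <= d n).

Lemma exhausted_line : exhausted [set: R].
Proof.
exists (fun n => - n%:R), (fun n => n%:R); split=> // x _.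
exists (Num.truncn `|x|).+1; rewrite -ler_norml ltW//.
exact: truncnS_gt.
Qed.

Lemma exhausted_half_line : exhausted half_line.
Proof.
exists (fun=> 0), (fun n => n%:R); split=> [n|x].
  by rewrite /half_line /= !in_itv/= lexx ler0n.
rewrite /half_line /= in_itv/= andbT => x0; exists (Num.truncn `|x|).+1.
by rewrite x0/= (le_trans (ler_norm _))// ltW// truncnS_gt.
Qed.

Lemma exhausted_edge (G : metric_graph R) (e : edge G) : exhausted (edge_interval e).
Proof.
have := edge_interval0 e; rewrite /edge_interval.
case: (edge_length e) => [l||] h0; [|exact: exhausted_half_line..].
exists (fun=> 0), (fun=> l); split=> [n|x]; last first.
  by rewrite /= in_itv/= => x0l; exists 0%N.
by split=> //; move: h0; rewrite /= !in_itv/= !lexx/= andbT.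
Qed.

(** The factor [c] serves the renormalization of the mass of the trial functions; [c = 1] gives the
    profile itself. *)
Lemma smooth_H1 (p : R) I w dw (m d q c : R) : is_interval I -> exhausted I ->
  (forall x : R, is_derive x 1 w (dw x)) -> continuous dw -> 0 < p -> 0 <= c ->
  mass I w = m%:E -> mass I dw = d%:E -> Lp_power p I w = q%:E ->
  [/\ H1 I (fun x => c * w x), mass I (fun x => c * w x) = (c ^+ 2 * m)%:E,
      dirichlet I (fun x => c * w x) = (c ^+ 2 * d)%:E &
      Lp_power p I (fun x => c * w x) = (c `^ p * q)%:E].
Proof.
move=> Iitv [c1 [d1 [Icd cov]]] dww cdw p0 c0 wm dwd wq.
have mI : measurable (I : set (measurableTypeR R)) by exact: is_interval_measurable.
have cw : continuous w.
  by move=> x; apply/differentiable_continuous/derivable1_diffP; case: (dww x).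
have massZ f t : continuous f -> mass I f = t%:E -> mass I (fun x => c * f x) = (c ^+ 2 * t)%:E.
  move=> cf ft; rewrite EFinM -ft -ge0_integralZl_EFin ?sqr_ge0//.
  - by apply: eq_integral => x _; rewrite exprMn EFinM.
  - by move=> x _; rewrite lee_fin sqr_ge0.
  - apply/measurable_EFinP; apply: measurable_funX; apply: measurable_funTS.
    exact: continuous_measurable_fun.
have dcw (x : R) : is_derive x 1 (fun x => c * w x) (c * dw x).
  by have h := dww x; apply: (@is_deriveZ _ _ _ w c x 1 (dw x)).
have ccdw : continuous (fun x => c * dw x).
  by move=> x; apply: cvgM; [exact: cvg_cst|exact: cdw].
have m1 := massZ _ _ cw wm; have m2 := massZ _ _ cdw dwd.
have [||H D] := @C1_H1 _ I _ _ c1 d1 Iitv Icd cov dcw ccdw.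
- by rewrite m1 ltry.
- by rewrite m2 ltry.
split=> //; first by rewrite D.
rewrite EFinM -wq -ge0_integralZl_EFin ?powR_ge0//.
- by apply: eq_integral => x _; rewrite normrM (ger0_norm c0) powRM// EFinM.
- apply/measurable_EFinP.
  apply: (@measurableT_comp _ _ _ _ _ _ (fun y : R => y `^ p)) => //.
  apply: measurableT_comp => //; apply: measurable_funTS.
  exact: continuous_measurable_fun.
Qed.

End SmoothFunctions.

(** * Trial functions on the graph *)

Section GraphUpperBound.
Context {R : realType}.
Local Notation leb := (@lebesgue_measure R).
Variables (G : metric_graph R) (e0 : edge G).
Hypothesis e0_half_line : is_half_line e0.

(* [f] is centered at distance [s] from the vertex of [e0], and the rest of the
   graph carries the tail of [f] beyond [s]; [v] is the value on bounded edges. *)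
Definition spread (f : R -> R) (v : R) (e : edge G) (s x : R) : R :=
  if e == e0 then f (x - s) else if is_half_line e then f (x + s) else v.

(** For an even function with tail integrals [tail], the integral over the line is [2 * tail 0]; on
    [e0] the tail cut off by the vertex is missing. [fine] is only applied to the length of a
    bounded edge. *)
Definition spread_integral (tail : R -> R) (v : R) (e : edge G) (s : R) : R :=
  if e == e0 then 2 * tail 0 - tail s
  else if is_half_line e then tail s else fine (edge_length e) * v.

Lemma half_line_interval (e : edge G) : is_half_line e -> edge_interval e = half_line.
Proof. by rewrite /is_half_line /edge_interval => /eqP ->. Qed.

Lemma half_line_length (e : edge G) (l : R) : is_half_line e -> edge_length e <> l%:E.
Proof. by rewrite /is_half_line => /eqP ->. Qed.

Lemma integral_spread (f tail : R -> R) (v s : R) (e : edge G) :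
  continuous f -> (forall x, 0 <= f x) -> (forall x, f (- x) = f x) -> 0 <= s ->
  (forall t, 0 <= t -> (\int[leb]_(x in `[t, +oo[) (f x)%:E = (tail t)%:E)%E) ->
  (\int[leb]_(x in edge_interval e) (spread f v e s x)%:E =
   (spread_integral tail v e s)%:E)%E.
Proof.
move=> cf f0 ef s0 tailE; rewrite /spread /spread_integral.
have lineE := even_integral_line cf f0 ef (tailE 0 (lexx 0)).
case: eqP => [->|_].
  rewrite half_line_interval// integral_half_line_shift//.
  exact: even_integral_shifted_line lineE (tailE s s0).
case: ifPn => [he|hne].
  by rewrite half_line_interval// integral_half_line_shift// tailE.
have := edge_length_gt0 e; move: hne; rewrite /is_half_line /edge_interval.
case: (edge_length e) => [l||]//= _ l0.
rewrite integral_cst//= lebesgue_measure_itv/= l0 oppr0 adde0 -EFinM.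
by rewrite mulrC.
Qed.

Lemma spread_integral_cvg (tail v : R -> R) :
  tail s @[s --> +oo] --> (0 : R) -> v s @[s --> +oo] --> (0 : R) ->
  \sum_e spread_integral tail (v s) e s @[s --> +oo] --> 2 * tail 0.
Proof.
move=> tail0 v0.
have -> : 2 * tail 0 = \sum_e (if e == e0 then 2 * tail 0 else 0).
  by rewrite -big_mkcond/= big_pred1_eq.
apply: cvg_big => [|e _]; first exact: add_continuous.
rewrite /spread_integral; case: eqP => _.
  rewrite -[X in _ --> X]subr0; apply: cvgB => //; exact: cvg_cst.
case: (is_half_line e) => //; rewrite -[X in _ --> X](mulr0 (fine (edge_length e))).
by apply: cvgM => //; exact: cvg_cst.
Qed.

Variable p : R.
Hypothesis p_gt2 : 2 < p.
Let p_gt0 : 0 < p. Proof. by rewrite (lt_trans _ p_gt2). Qed.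
Variables (M k : R) (M_gt0 : 0 < M) (k_gt0 : 0 < k).
Local Notation phi := (profile p M k).
Local Notation dphi := (dprofile p M k).
Local Notation tail_D := (tail_dirichlet p M k).
Local Notation tail_P := (fun s => M `^ (p - 2) * tail_power p M k s).
Local Notation tail_m := (tail_mass p M k).

(** Every vertex at finite distance receives the value [phi s], so bounded edges carry this constant
    and gluing holds whatever the shape of the graph. *)
Let trial (e : edge G) (s x : R) : R := spread phi (phi s) e s x.
Let dtrial (e : edge G) (s x : R) : R := spread dphi 0 e s x.

Let is_derive_trial e s (x : R) : is_derive x 1 (trial e s) (dtrial e s x).
Proof.
have sh (t : R) : is_derive x 1 (fun y => phi (y + t)) (dphi (x + t)).
  have ht := is_deriveD (is_derive_id x (1 : R)) (is_derive_cst t x (1 : R)).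
  have := @is_derive1_comp _ phi (id + cst t) x _ _ (is_derive_profile p M k (x + t)) ht.
  by rewrite addr0 mulr1.
rewrite /trial /dtrial /spread; case: (e == e0); first exact: sh.
by case: ifP => _; [exact: sh|exact: is_derive_cst].
Qed.

Let continuous_dtrial e s : continuous (dtrial e s).
Proof.
have sh (t : R) : continuous (fun x => dphi (x + t)).
  move=> x; apply: (@continuous_comp _ _ _ (fun x => x + t) dphi).
    by apply: cvgD; [exact: cvg_id|exact: cvg_cst].
  exact: continuous_dprofile.
rewrite /dtrial /spread; case: (e == e0); first exact: sh.
by case: (is_half_line e); [exact: sh|exact: cst_continuous].
Qed.

Let trial_integrals e s : 0 <= s ->
  [/\ mass (edge_interval e) (trial e s) = (spread_integral tail_m (phi s ^+ 2) e s)%:E,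
      mass (edge_interval e) (dtrial e s) = (spread_integral tail_D 0 e s)%:E &
      Lp_power p (edge_interval e) (trial e s) =
        (spread_integral tail_P (phi s `^ p) e s)%:E].
Proof.
move=> s0; split.
- have c : continuous (fun x => phi x ^+ 2).
    by move=> x; apply: cvg_sqr; exact: continuous_profile.
  have n x : 0 <= phi x ^+ 2 by exact: sqr_ge0.
  have ev x : phi (- x) ^+ 2 = phi x ^+ 2 by rewrite profileN.
  have i t : 0 <= t -> (\int[leb]_(x in `[t, +oo[) (phi x ^+ 2)%:E = (tail_m t)%:E)%E.
    exact: integral_profile_sqr.
  rewrite -(integral_spread (phi s ^+ 2) e c n ev s0 i).
  apply: eq_integral => x _; rewrite /trial /spread.
  by case: (e == e0) => //; case: (is_half_line e).
- have c : continuous (fun x => dphi x ^+ 2).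
    by move=> x; apply: cvg_sqr; exact: continuous_dprofile.
  have n x : 0 <= dphi x ^+ 2 by exact: sqr_ge0.
  have ev x : dphi (- x) ^+ 2 = dphi x ^+ 2 by rewrite dprofileN sqrrN.
  have i t : 0 <= t -> (\int[leb]_(x in `[t, +oo[) (dphi x ^+ 2)%:E = (tail_D t)%:E)%E.
    exact: integral_dprofile.
  rewrite -(integral_spread 0 e c n ev s0 i).
  apply: eq_integral => x _; rewrite /dtrial /spread.
  by case: (e == e0) => //; case: (is_half_line e) => //; rewrite expr0n.
- have c : continuous ((fun y : R => `|y| `^ p) \o phi).
    move=> x; apply: continuous_comp; first exact: continuous_profile.
    exact: (continuous_norm_powR p_gt2).
  have n x : 0 <= ((fun y : R => `|y| `^ p) \o phi) x by exact: powR_ge0.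
  have ev x : ((fun y : R => `|y| `^ p) \o phi) (- x) = ((fun y : R => `|y| `^ p) \o phi) x.
    by rewrite /= profileN.
  have i t : 0 <= t -> (\int[leb]_(x in `[t, +oo[) (`|phi x| `^ p)%:E = (tail_P t)%:E)%E.
    exact: integral_profile_powR.
  rewrite -(integral_spread (phi s `^ p) e c n ev s0 i).
  apply: eq_integral => x _; rewrite /trial /spread.
  case: (e == e0) => //; case: (is_half_line e) => //.
  by rewrite gtr0_norm// profile_gt0.
Qed.

Let total (tail : R -> R) (v s : R) : R := \sum_e spread_integral tail v e s.

Let trial_energy (c s : R) : 0 <= s -> 0 <= c ->
  let u := fun e x => c * trial e s x in
  [/\ graph_H1 u,
      (\sum_e mass (edge_interval e) (u e) = (c ^+ 2 * total tail_m (phi s ^+ 2) s)%:E)%E &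
      graph_energy p u = (2^-1 * (c ^+ 2 * total tail_D 0 s) -
        p^-1 * (c `^ p * total tail_P (phi s `^ p) s))%:E].
Proof.
move=> s0 c0 u.
have ue e : [/\ H1 (edge_interval e) (u e),
    mass (edge_interval e) (u e) = (c ^+ 2 * spread_integral tail_m (phi s ^+ 2) e s)%:E,
    dirichlet (edge_interval e) (u e) = (c ^+ 2 * spread_integral tail_D 0 e s)%:E &
    Lp_power p (edge_interval e) (u e) = (c `^ p * spread_integral tail_P (phi s `^ p) e s)%:E].
  have [h1 h2 h3] := trial_integrals e s0.
  exact: (smooth_H1 (@edge_interval_is_interval _ G e) (exhausted_edge e)
    (is_derive_trial e s) (@continuous_dtrial e s) p_gt0 c0 h1 h2 h3).
have sumE (F : edge G -> \bar R) (f : edge G -> R) (t : R) :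
    (forall e, F e = (t * f e)%:E) -> (\sum_e F e = (t * \sum_e f e)%:E)%E.
  by move=> Ff; rewrite mulr_sumr -sumEFin; apply: eq_bigr => e _.
split.
- split; last by move=> e; case: (ue e).
  exists (fun=> c * phi s) => e; rewrite /u /trial /spread.
  case: eqP => [->|_].
    split=> [|l el]; last by case: (half_line_length e0_half_line el).
    by rewrite sub0r profileN.
  case: (boolP (is_half_line e)) => [he|_]; last by split=> [|l _]; exact: erefl.
  split=> [|l el]; last by case: (half_line_length he el).
  by rewrite add0r.
- by apply: sumE => e; case: (ue e).
- rewrite /graph_energy (sumE _ (fun e => spread_integral tail_D 0 e s) (c ^+ 2)).
    rewrite (sumE _ (fun e => spread_integral tail_P (phi s `^ p) e s) (c `^ p)).
      by rewrite -!EFinM -EFinB.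
    by move=> e; case: (ue e).
  by move=> e; case: (ue e).
Qed.

Lemma graph_energy_inf_le (mu : R) : 0 < mu -> mu = 2 * tail_m 0 ->
  (ereal_inf (graph_energy p @` graph_H1_mass G mu) <=
   (2 * (2^-1 * tail_D 0 - p^-1 * tail_P 0))%:E)%E.
Proof.
move=> mu0 muE.
pose m s := total tail_m (phi s ^+ 2) s.
pose D s := total tail_D 0 s.
pose P s := total tail_P (phi s `^ p) s.
have phi0 : phi s @[s --> +oo] --> (0 : R) by exact: profile_cvg0.
have phi2 : phi s ^+ 2 @[s --> +oo] --> (0 : R).
  have -> : 0 = (0 : R) ^+ 2 by rewrite expr0n.
  exact: cvg_sqr.
have phip : phi s `^ p @[s --> +oo] --> (0 : R).
  have h : `|phi s| `^ p @[s --> +oo] --> (`|0 : R| `^ p).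
    apply: (@cvg_comp _ _ _ phi (fun y : R => `|y| `^ p)); first exact: phi0.
    exact: (continuous_norm_powR p_gt2).
  rewrite normr0 powR0 ?gt_eqF// in h.
  apply: cvg_trans h; apply: near_eq_cvg; apply: nearW => s.
  by rewrite gtr0_norm// profile_gt0.
have tP0 : tail_P s @[s --> +oo] --> (0 : R).
  rewrite -(mulr0 (M `^ (p - 2))); apply: cvgM; first exact: cvg_cst.
  exact: tail_power_cvg0.
have mcvg : m s @[s --> +oo] --> mu.
  by rewrite muE; apply: spread_integral_cvg => //; exact: tail_mass_cvg0.
have Dcvg : D s @[s --> +oo] --> 2 * tail_D 0.
  apply: (@spread_integral_cvg _ (fun=> 0)); first exact: tail_dirichlet_cvg0.
  exact: cvg_cst.
have Pcvg : P s @[s --> +oo] --> 2 * tail_P 0.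
  exact: (spread_integral_cvg tP0 phip).
have rcvg : mu / m s @[s --> +oo] --> (1 : R).
  have <- : mu / mu = 1 by rewrite divff// gt_eqF.
  apply: cvgM; first exact: cvg_cst.
  by apply: cvgV => //; rewrite gt_eqF.
have rpcvg : (mu / m s) `^ (p / 2) @[s --> +oo] --> (1 : R).
  have c1 : {for (1 : R), continuous (fun y : R => y `^ (p / 2))}.
    apply/differentiable_continuous/derivable1_diffP/derivable_powR.
    by rewrite in_itv/= andbT.
  suff : (mu / m s) `^ (p / 2) @[s --> +oo] --> (1 : R) `^ (p / 2) by rewrite powR1.
  apply: (@cvg_comp _ _ _ (fun s => mu / m s) (fun y : R => y `^ (p / 2))); first exact: rcvg.
  exact: c1.
(* The energy of [c] times the trial function when [c ^+ 2 = mu / m s]. The power [p] of [c] is the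
   power [p / 2] of this ratio, so the square root does not enter the limit. *)
pose E s := 2^-1 * (mu / m s * D s) - p^-1 * ((mu / m s) `^ (p / 2) * P s).
have Ecvg : E s @[s --> +oo] --> 2 * (2^-1 * tail_D 0 - p^-1 * tail_P 0).
  have -> : 2 * (2^-1 * tail_D 0 - p^-1 * tail_P 0) =
      2^-1 * (1 * (2 * tail_D 0)) - p^-1 * (1 * (2 * tail_P 0)) by ring.
  apply: cvgB; (apply: cvgM; first exact: cvg_cst).
    exact: cvgM.
  exact: cvgM.
apply/lee_addgt0Pr; suff main (d : R) : 0 < d ->
  (ereal_inf (graph_energy p @` graph_H1_mass G mu) <=
   (2 * (2^-1 * tail_D 0 - p^-1 * tail_P 0))%:E + d%:E)%E by exact: main.
move=> d0.
have [s [s0 ms Es]] : exists s, [/\ 0 <= s, 0 < m s &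
    E s <= 2 * (2^-1 * tail_D 0 - p^-1 * tail_P 0) + d].
  near (+oo : set_system R) => s; exists s; split.
  - by near: s; apply: nbhs_pinfty_ge; rewrite num_real.
  - by near: s; apply: (cvgr_gt mu).
  - by near: s; apply: (cvgr_le _ Ecvg); rewrite ltrDl.
have r0 : 0 <= mu / m s by rewrite divr_ge0 ?ltW.
pose c := Num.sqrt (mu / m s).
have c0 : 0 <= c by exact: sqrtr_ge0.
have c2 : c ^+ 2 = mu / m s by rewrite sqr_sqrtr.
have cp : c `^ p = (mu / m s) `^ (p / 2).
  rewrite -c2 -powR_mulrn// -powRrM; congr (_ `^ _); by field.
have [uH1 um uE] := trial_energy s0 c0.
apply: (@le_trans _ _ (E s)%:E); last by rewrite -EFinD lee_fin.
apply: ereal_inf_lbound; exists (fun e x => c * trial e s x).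
  by split=> //; rewrite um c2 -/(m s) divfK// gt_eqF.
by rewrite uE c2 cp.
Unshelve. all: by end_near. Qed.

End GraphUpperBound.

(** * The profile on the half-line and on the line *)

Section SolitonExistence.
Context {R : realType}.
Local Notation leb := (@lebesgue_measure R).
Variable p : R.
Hypotheses (p_gt2 : 2 < p) (p_lt6 : p < 6).
Let p_gt0 : 0 < p. Proof. by rewrite (lt_trans _ p_gt2). Qed.

Lemma smooth_energy (I : set R) (w dw : R -> R) (m d q : R) : is_interval I -> exhausted I ->
  (forall x : R, is_derive x 1 w (dw x)) -> continuous dw ->
  mass I w = m%:E -> mass I dw = d%:E -> Lp_power p I w = q%:E ->
  H1_mass I m w /\ energy p I w = (2^-1 * d - p^-1 * q)%:E.
Proof.
move=> Iitv Iex dww cdw wm dwd wq.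
have := smooth_H1 Iitv Iex dww cdw p_gt0 ler01 wm dwd wq.
have -> : (fun x => 1 * w x) = w by apply/funext => x; rewrite mul1r.
rewrite expr1n powR1 !mul1r => -[wH1 _ dw1 _].
by split; [split|rewrite /energy dw1 wq -!EFinM -EFinB].
Qed.

Variables (M k : R) (M_gt0 : 0 < M) (k_gt0 : 0 < k).
Local Notation phi := (profile p M k).
Local Notation dphi := (dprofile p M k).
Local Notation half_energy :=
  (2^-1 * tail_dirichlet p M k 0 - p^-1 * (M `^ (p - 2) * tail_power p M k 0)).

Let half_mass : mass half_line phi = (tail_mass p M k 0)%:E.
Proof. exact: integral_profile_sqr. Qed.

Let half_dirichlet : mass half_line dphi = (tail_dirichlet p M k 0)%:E.
Proof. exact: integral_dprofile. Qed.

Let half_power : Lp_power p half_line phi = (M `^ (p - 2) * tail_power p M k 0)%:E.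
Proof. exact: integral_profile_powR. Qed.

Lemma profile_half_line_energy :
  H1_mass half_line (tail_mass p M k 0) phi /\ energy p half_line phi = half_energy%:E.
Proof.
exact: (smooth_energy half_line_is_interval exhausted_half_line
  (is_derive_profile p M k) (@continuous_dprofile _ p M k) half_mass half_dirichlet half_power).
Qed.

Lemma profile_line_energy :
  H1_mass [set: R] (2 * tail_mass p M k 0) phi /\ energy p [set: R] phi = (2 * half_energy)%:E.
Proof.
have -> : 2 * half_energy = 2^-1 * (2 * tail_dirichlet p M k 0) -
    p^-1 * (2 * (M `^ (p - 2) * tail_power p M k 0)) by ring.
have m : mass [set: R] phi = (2 * tail_mass p M k 0)%:E.
  have c : continuous (fun x => phi x ^+ 2).
    by move=> x; apply: cvg_sqr; exact: continuous_profile.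
  apply: (even_integral_line c _ _ half_mass) => x; first exact: sqr_ge0.
  by rewrite profileN.
have d : mass [set: R] dphi = (2 * tail_dirichlet p M k 0)%:E.
  have c : continuous (fun x => dphi x ^+ 2).
    by move=> x; apply: cvg_sqr; exact: continuous_dprofile.
  apply: (even_integral_line c _ _ half_dirichlet) => x; first exact: sqr_ge0.
  by rewrite dprofileN sqrrN.
have q : Lp_power p [set: R] phi = (2 * (M `^ (p - 2) * tail_power p M k 0))%:E.
  have c : continuous (fun x => `|phi x| `^ p).
    move=> x; apply: (@continuous_comp _ _ _ phi (fun y : R => `|y| `^ p)).
      exact: continuous_profile.
    exact: (continuous_norm_powR p_gt2).
  apply: (even_integral_line c _ _ half_power) => x; first exact: powR_ge0.
  by rewrite profileN.
have Titv : is_interval [set: R] by [].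
exact: (smooth_energy Titv exhausted_line
  (is_derive_profile p M k) (@continuous_dprofile _ p M k) m d q).
Qed.

End SolitonExistence.

(** * The chosen soliton and the conclusion *)

(** [soliton] is picked by [get]. Two minimizers have the same energy, so any explicit one
    determines the energy of the picked one. *)
Lemma is_soliton_soliton (R : realType) (p mu : R) (phi : R -> R) :
  is_soliton p mu phi ->
  is_soliton p mu (soliton p mu) /\ energy p [set: R] (soliton p mu) = energy p [set: R] phi.
Proof.
move=> hphi.
have hs : is_soliton p mu (soliton p mu).
  exact: (@getPex _ [set phi | is_soliton p mu phi] (ex_intro _ phi hphi)).
split; first exact: hs.
have [_ _ phiH [_ phimin]] := hphi; have [_ _ sH [_ smin]] := hs.
by apply/le_anti/andP; split; [apply: smin; exists phi|apply: phimin; exists (soliton p mu)].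
Qed.

(** The parameters belong to [mu / 2], the mass of the profile on [0, +oo[. On the line its energy
    doubles and meets the lower bound with [n = 2], so the profile is a minimizer. *)
Lemma soliton_energy (R : realType) (p mu : R) : 2 < p -> p < 6 -> 0 < mu ->
  is_soliton p mu (soliton p mu) /\ exists M k : R,
  [/\ 0 < M, 0 < k, tail_mass p M k 0 = mu / 2,
    energy p [set: R] (soliton p mu) = (2 * energy_profile p 1 (mu / 2) M)%:E &
    2^-1 * tail_dirichlet p M k 0 - p^-1 * (M `^ (p - 2) * tail_power p M k 0) =
      energy_profile p 1 (mu / 2) M /\
    forall N, 0 < N -> energy_profile p 1 (mu / 2) M <= energy_profile p 1 (mu / 2) N].
Proof.
move=> p_gt2 p_lt6 mu0; have mu2 : 0 < mu / 2 by rewrite divr_gt0.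
have [M [k [M0 k0 mE [hE Emin]]]] := ground_state_parameters p_gt2 p_lt6 mu2.
have massE : 2 * tail_mass p M k 0 = mu by rewrite mE; field.
have [phiH phiE] := profile_line_energy p_gt2 M0 k0.
rewrite massE in phiH.
have {}phiE := etrans phiE (congr1 (fun z => (2 * z)%:E) hE).
have phi_soliton : is_soliton p mu (profile p M k).
  split; [exact: profile_gt0|exact: profileN|exact: phiH|].
  split; first by exists (profile p M k).
  move=> _ [u uH <-]; have [N N0] := line_lower_bound p_gt2 mu0 uH.
  have EMN : 2 * energy_profile p 1 (mu / 2) M <= energy_profile p 2 mu N.
    by rewrite energy_profile2 ?ler_pM2l//; exact: Emin.
  by apply: le_trans; rewrite phiE lee_fin.
have [hs sE] := is_soliton_soliton phi_soliton.
split; first exact: hs.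
exists M, k; split; [exact: M0|exact: k0|exact: mE| |split; [exact: hE|exact: Emin]].
by rewrite sE phiE.
Qed.

Theorem theorem2p2 (R : realType) (mu p : R) (mu_gt0 : 0 < mu)
    (p_gt2 : 2 < p) (p_lt6 : p < 6) (G : metric_graph R)
    (G_half_line : exists e : edge G, is_half_line e) :
  [/\ is_minimum (energy p [set: R]) (H1_mass [set: R] mu)
        (energy p [set: R] (soliton p mu)),
      (ereal_inf (graph_energy p @` graph_H1_mass G mu) <=
        energy p [set: R] (soliton p mu))%E,
      is_minimum (energy p half_line) (H1_mass half_line mu)
        ((2^-1)%:E * energy p [set: R] (soliton p (2 * mu)))%E &
      ((2^-1)%:E * energy p [set: R] (soliton p (2 * mu)) <=
        ereal_inf (graph_energy p @` graph_H1_mass G mu))%E].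
Proof.
have [[_ _ _ smin] [M [k [M0 k0 mE sE [hE _]]]]] := soliton_energy p_gt2 p_lt6 mu_gt0.
have mu2 : 0 < 2 * mu by rewrite mulr_gt0.
(* At mass [2 * mu] the restriction of the profile to [0, +oo[ has mass [mu]. Its energy is the
   minimal value of [energy_profile p 1 mu], a lower bound on the half-line as well as on the
   graph. *)
have [_ [M' [k' [M'0 k'0 mE' sE' [hE' Emin']]]]] := soliton_energy p_gt2 p_lt6 mu2.
have mu2E : 2 * mu / 2 = mu by field.
rewrite mu2E in mE' sE' hE' Emin'.
have halfE : ((2^-1)%:E * energy p [set: R] (soliton p (2 * mu)) =
    (energy_profile p 1 mu M')%:E)%E.
  by rewrite sE' -EFinM; congr (_%:E); field.
split; first exact: smin.
- have [e0 he0] := G_half_line.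
  rewrite sE -hE; apply: (graph_energy_inf_le he0 p_gt2 M0 k0 mu_gt0).
  by rewrite mE; field.
- rewrite halfE; split.
    have [phiH phiE] := profile_half_line_energy p_gt2 M'0 k'0.
    by exists (profile p M' k'); [rewrite mE' in phiH|rewrite phiE hE'].
  move=> _ [u uH <-]; have [N N0] := half_line_lower_bound p_gt2 mu_gt0 uH.
  by apply: le_trans; rewrite lee_fin Emin'.
- rewrite halfE; apply: le_ereal_inf_tmp => _ [u uH <-].
  have [N N0] := graph_lower_bound p_gt2 G_half_line mu_gt0 uH.
  by apply: le_trans; rewrite lee_fin Emin'.
Qed.
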